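(* Let $H\in[\frac12,1)$. For all $r\in\mathbb{N}$, $1<p<\infty$ and $t\in[0,1]$, the sequence $(B^{(m)}_t)_{m}$ converges $(p,r)$-quasi-surely to some limit, denoted again by $B_t$, which is also the limit of $(B_t^{(m)})_{m}$ in $\mathbb{D}^p_r$. Here $B_0^{(m)}=0$ and, for $t>0$ and $m=1,2,\dots$, $$B^{(m)}_t(\omega)=\sum_{i=0}^{2^m-1}\frac{2^m}{t}\int_{\frac{i}{2^m}t}^{\frac{i+1}{2^m}t}K(t,u)\,du\,\Big(\omega_{\frac{i+1}{2^m}t}-\omega_{\frac{i}{2^m}t}\Big),\qquad \omega\in\boldsymbol{W}.$$
   Context: **Classical Wiener space.** $\boldsymbol{W}$ is the space of real-valued continuous paths on $[0,1]$ starting at $0$, with the uniform norm; $\mathbb{P}$ is Wiener measure on it (so the coordinate process $\omega(t)=\omega_t$ is a standard Brownian motion); $\mathscr{H}$ is the Cameron-Martin space of absolutely continuous $h$ with $h(0)=0$ and $\dot h\in L^2([0,1])$, with $\langle h,g\rangle_{\mathscr{H}}=\int_0^1\dot h\dot g\,ds$. For $h\in\mathscr{H}$, $[h](\omega)=\int_0^1\dot h(s)\,d\omega(s)$ (Itô integral). **Sobolev norms.** A smooth random variable is $F=f([h_1],\dots,[h_n])$ with $h_i\in\mathscr{H}$ and $f\in C^\infty(\mathbb{R}^n)$ having, together with all its partial derivatives, polynomial growth; its Malliavin derivative is $DF=\sum_i\partial_if([h_1],\dots,[h_n])h_i$, and $D^lF$ is defined inductively. For $r=0,1,2,\dots$ and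 $1\le p<\infty$, $\|F\|_{\mathbb{D}^p_r}=\big(\mathbb{E}|F|^p+\sum_{l=1}^r\mathbb{E}\|D^lF\|_{\mathscr{H}^{\otimes l}}^p\big)^{1/p}$, and $\mathbb{D}^p_r$ is the completion of the smooth random variables in this norm. **Capacity.** For open $O\subset\boldsymbol{W}$, $c_{p,r}(O)=\inf\{\|\varphi\|_{\mathbb{D}^p_r}:\varphi\in\mathbb{D}^p_r,\ \varphi\ge1\text{ a.e. on }O,\ \varphi\ge0\text{ a.e. on }\boldsymbol{W}\}$; for arbitrary $A\subset\boldsymbol{W}$, $c_{p,r}(A)=\inf\{c_{p,r}(O):A\subset O,\ O\text{ open}\}$. A property holds $(p,r)$-quasi-surely if the set of $\omega$ where it fails has $c_{p,r}$-capacity zero; thus $(p,r)$-quasi-sure convergence means pointwise convergence outside a set of $c_{p,r}$-capacity zero. **Kernel.** For $H>\frac12$, $K(t,s)=c_Hs^{\frac12-H}\int_s^t(u-s)^{H-\frac32}u^{H-\frac12}\,du$ for $0<s<t$, where $c_H>0$ is the constant depending only on $H$ for which the process $B_t(\omega)=\int_0^tK(t,s)\,d\omega(s)$ is a fractional Brownian motion with Hurst parameter $H$, i.e. a centred Gaussian process with covariance $\frac12(s^{2H}+t^{2H}-|t-s|^{2H})$. For $H=\frac12$, $K(t,s)=1$ for $s<t$. *)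

(* Defs.v *)
From HB Require Import structures.
From mathcomp Require Import all_boot all_order all_algebra.
From mathcomp Require Import all_classical all_reals all_analysis.

Set Implicit Arguments.
Unset Strict Implicit.
Unset Printing Implicit Defensive.
Import Order.TTheory GRing.Theory Num.Theory.
Import numFieldNormedType.Exports.

Local Open Scope classical_set_scope.
Local Open Scope ring_scope.

(* Paths on [0, 1] are extended by 0 to functions on R: equality of paths is
   then equality on [0, 1], and uniform convergence on R is uniform convergence
   on [0, 1]. *)
Definition wiener_paths (R : realType) : set {uniform R -> R} :=
  [set w | [/\ {within `[0, 1], continuous (w : R -> R)}, w 0 = 0
             & forall t, t \notin `[0, 1] -> w t = 0]].

Definition wiener (R : realType) : Type := set_type (@wiener_paths R).

HB.instance Definition _ (R : realType) :=
  Uniform.copy (wiener R) (set_type (@wiener_paths R)).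

Definition wiener_val (R : realType) (w : wiener R) : R -> R := set_val w.
Coercion wiener_val : wiener >-> Funclass.

Lemma wiener_paths0 (R : realType) : wiener_paths (cst (0 : R)).
Proof. by split=> // x; exact: cst_continuous. Qed.

HB.instance Definition _ (R : realType) :=
  isPointed.Build (wiener R)
    (SigSub (mem_set (@wiener_paths0 R)) : set_type (@wiener_paths R)).

(* the Borel sigma-algebra of the uniform topology *)
HB.instance Definition _ (R : realType) :=
  Measurable.copy (wiener R) (g_sigma_algebraType (@open (wiener R))).

(* The coordinate process starts at 0 and is continuous by definition of
   [wiener]; what remains is that its increments over consecutive intervals are
   independent and that each has law N(0, t_{i+1} - t_i). The second parameter
   of [normal_prob] is the standard deviation. *)
Definition wiener_measure (R : realType) (P : probability (wiener R) R) : Prop :=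
  forall (n : nat) (t : nat -> R) (A : nat -> set R),
    0 <= t 0%N -> t n <= 1 ->
    (forall i, (i < n)%N -> t i < t i.+1) ->
    (forall i, measurable (A i)) ->
    P [set w : wiener R | forall i, (i < n)%N -> A i (w (t i.+1) - w (t i))] =
    (\prod_(0 <= i < n) normal_prob 0 (Num.sqrt (t i.+1 - t i)) (A i))%E.

Section cameron_martin.
Context {R : realType}.
Local Notation mu := (@lebesgue_measure R).

Definition absolutely_continuous01 (h : R -> R) : Prop :=
  forall e : R, 0 < e -> exists2 d : R, 0 < d &
    forall (n : nat) (a b : 'I_n -> R),
      (forall i, 0 <= a i /\ a i <= b i /\ b i <= 1) ->
      trivIset [set: 'I_n] (fun i => `]a i, b i[%classic) ->
      \sum_i (b i - a i) < d ->
      \sum_i `|h (b i) - h (a i)| < e.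

(* [derive1 h] is the derivative wherever it exists, hence a.e. on [0, 1]. *)
Record cameron_martin := CameronMartin {
  cm_path :> wiener R ;
  cm_ac : absolutely_continuous01 cm_path ;
  cm_L2 : (\int[mu]_(s in `[0%R, 1%R]) ((derive1 cm_path s) ^+ 2)%:E < +oo)%E }.

Definition cm_inner (h g : cameron_martin) : R :=
  \int[mu]_(s in `[0, 1]) (derive1 h s * derive1 g s).

(* Finite formal sums of elementary tensors a (u_1 (x) ... (x) u_l), with the
   inner product of the algebraic tensor product; for l = 0 this is R. *)
Definition tensor (l : nat) : Type := seq (R * l.-tuple cameron_martin).

Definition tensor_sub l (T U : tensor l) : tensor l :=
  T ++ [seq (- u.1, u.2) | u <- U].

Definition tensor_inner l (T U : tensor l) : R :=
  \sum_(a <- T) \sum_(b <- U)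
    a.1 * b.1 * \prod_(k < l) cm_inner (tnth a.2 k) (tnth b.2 k).

Definition tensor_norm l (T : tensor l) : R := Num.sqrt (tensor_inner T T).

End cameron_martin.

Arguments cameron_martin : clear implicits.
Arguments tensor : clear implicits.

Section wiener_integral.
Context {R : realType}.
Variable P : probability (wiener R) R.
Local Notation mu := (@lebesgue_measure R).

Record step := Step {
  step_size : nat ;
  step_coef : 'I_step_size -> R ;
  step_lo : 'I_step_size -> R ;
  step_hi : 'I_step_size -> R ;
  step_le : forall i, 0 <= step_lo i /\ step_lo i <= step_hi i /\ step_hi i <= 1 }.

Definition step_fun (f : step) (s : R) : R :=
  \sum_(i < step_size f) step_coef i * \1_(`]step_lo i, step_hi i]) s.

Definition step_integral (f : step) (w : wiener R) : R :=
  \sum_(i < step_size f) step_coef i * (w (step_hi i) - w (step_lo i)).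

(* X is a version of the Ito integral of the deterministic integrand
   g in L^2([0, 1]), i.e. the L^2(P)-limit of integrals of step functions. *)
Definition is_wiener_integral (g : R -> R) (X : wiener R -> R) : Prop :=
  [/\ measurable_fun (`[0, 1]%classic : set R) g, measurable_fun setT X &
    exists f : nat -> step,
      (fun k => \int[mu]_(s in `[0%R, 1%R]) ((step_fun (f k) s - g s) ^+ 2)%:E)%E
        @ \oo --> 0%E /\
      (fun k => \int[P]_w ((step_integral (f k) w - X w) ^+ 2)%:E)%E
        @ \oo --> 0%E].

End wiener_integral.

Section smooth_functionals.
Context {R : realType}.

Definition partial n (i : 'I_n) (f : 'rV[R]_n -> R) : 'rV[R]_n -> R :=
  fun x => 'D_(delta_mx 0 i) f x.

Definition iter_partial n (s : seq 'I_n) (f : 'rV[R]_n -> R) : 'rV[R]_n -> R :=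
  foldr (@partial n) f s.

(* C^oo with polynomial growth of all partial derivatives (s = [::] is f) *)
Definition smooth_poly_growth n (f : 'rV[R]_n -> R) : Prop :=
  forall s : seq 'I_n,
    [/\ continuous (iter_partial s f),
        forall i x, derivable (iter_partial s f) x (delta_mx 0 i) &
        exists (C : R) (N : nat),
          forall x, `|iter_partial s f x| <= C * (1 + `|x|) ^+ N].

(* F = f([h_1], ..., [h_n]); as [h_i] is only defined up to a null set, versions
   of these integrals are part of the data. *)
Record smooth_functional (P : probability (wiener R) R) := SmoothFunctional {
  sm_dim : nat ;
  sm_fun : 'rV[R]_sm_dim -> R ;
  sm_dir : 'I_sm_dim -> cameron_martin R ;
  sm_int : 'I_sm_dim -> wiener R -> R ;
  sm_smooth : smooth_poly_growth sm_fun ;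
  sm_intP : forall i, is_wiener_integral P (derive1 (sm_dir i)) (sm_int i) }.

Variable P : probability (wiener R) R.

Definition sm_eval (F : smooth_functional P) (g : 'rV[R]_(sm_dim F) -> R)
  (w : wiener R) : R := g (\row_i sm_int i w).

Definition sm_val (F : smooth_functional P) : wiener R -> R :=
  sm_eval (@sm_fun _ F).

(* D^l F as a formal sum of g([h_1], ..., [h_n]) h_{i_1} (x) ... (x) h_{i_l},
   each represented by (g, (i_1, ..., i_l)), using
   D (g([h]) v) = \sum_i (d_i g)([h]) h_i (x) v. *)
Fixpoint malliavin_terms n (f : 'rV[R]_n -> R) (l : nat) :
    seq (('rV[R]_n -> R) * l.-tuple 'I_n) :=
  match l with
  | 0 => [:: (f, [tuple])]
  | l'.+1 => [seq (partial i a.1, cons_tuple i a.2) |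
               a <- malliavin_terms f l', i <- enum 'I_n]
  end.

Definition malliavin (F : smooth_functional P) (l : nat) (w : wiener R) :
    tensor R l :=
  [seq (sm_eval a.1 w, map_tuple (@sm_dir _ F) a.2) |
     a <- malliavin_terms (@sm_fun _ F) l].

End smooth_functionals.

Section sobolev.
Context {R : realType}.
Variables (P : probability (wiener R) R) (p : R) (r : nat).

Definition sobolev_gauge (X : wiener R -> R)
    (T : forall l, wiener R -> tensor R l) : \bar R :=
  ((\int[P]_w (`|X w| `^ p)%:E +
    \sum_(1 <= l < r.+1) \int[P]_w (tensor_norm (T l w) `^ p)%:E) `^ p^-1)%E.

Definition smooth_norm (F : smooth_functional P) : \bar R :=
  sobolev_gauge (sm_val F) (malliavin F).

(* the norm of F - G *)
Definition smooth_dist (F G : smooth_functional P) : \bar R :=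
  sobolev_gauge (fun w => sm_val F w - sm_val G w)
    (fun l w => tensor_sub (malliavin F l w) (malliavin G l w)).

(* F is a Cauchy sequence for the Sobolev norm, and X is the random variable
   represented by its class in the completion. *)
Definition sobolev_approx (F : nat -> smooth_functional P) (X : wiener R -> R) :
    Prop :=
  [/\ measurable_fun setT X,
      forall e : R, 0 < e -> exists N, forall j k, (N <= j)%N -> (N <= k)%N ->
        (smooth_dist (F j) (F k) < e%:E)%E &
      (fun k => \int[P]_w (`|sm_val (F k) w - X w| `^ p)%:E)%E @ \oo --> 0%E].

Definition sobolev : set (wiener R -> R) :=
  [set X | exists F, sobolev_approx F X].

(* The norm of the completion, lim ||F_k||, and +oo outside of it. By
   closability of D the limit does not depend on the sequence F that
   represents X, so the infimum is over a singleton. *)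
Definition sobolev_norm (X : wiener R -> R) : \bar R :=
  ereal_inf [set c | exists2 F, sobolev_approx F X &
                       smooth_norm (F k) @[k --> \oo] --> c].

Definition cvg_sobolev (X : nat -> wiener R -> R) (Y : wiener R -> R) : Prop :=
  [/\ forall m, sobolev (X m), sobolev Y &
      sobolev_norm (fun w => X m w - Y w) @[m --> \oo] --> 0%E].

Definition open_capacity (O : set (wiener R)) : \bar R :=
  ereal_inf [set sobolev_norm X | X in
    [set X | [/\ sobolev X, {ae P, forall w, O w -> 1 <= X w}
               & {ae P, forall w, 0 <= X w}]]].

Definition capacity (A : set (wiener R)) : \bar R :=
  ereal_inf [set open_capacity O | O in [set O | open O /\ A `<=` O]].

Definition quasi_surely (Q : wiener R -> Prop) : Prop :=
  capacity [set w | ~ Q w] = 0%E.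

End sobolev.

Section fractional_brownian_motion.
Context {R : realType}.
Variable P : probability (wiener R) R.
Local Notation mu := (@lebesgue_measure R).

(* K(t, .), extended by 0 outside ]0, t[; c is the normalising constant c_H *)
Definition volterra_kernel (H c t s : R) : R :=
  if (0 < s) && (s < t) then
    if H == 2^-1 then 1
    else c * s `^ (2^-1 - H) *
      \int[mu]_(u in `]s, t[) ((u - s) `^ (H - 3 / 2) * u `^ (H - 2^-1))
  else 0.

Definition centred_gaussian (X : wiener R -> R) : Prop :=
  measurable_fun setT X /\ exists2 sigma : R, 0 <= sigma &
    forall A : set R, measurable A ->
      P (X @^-1` A) = if sigma == 0 then \d_(0 : R) A else normal_prob 0 sigma A.

Definition fbm (H : R) (B : R -> wiener R -> R) : Prop :=
  (forall (n : nat) (a t : 'I_n -> R), (forall i, t i \in `[0, 1]) ->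
     centred_gaussian (fun w => \sum_i a i * B (t i) w)) /\
  (forall s t, s \in `[0, 1] -> t \in `[0, 1] ->
     covariance P (B s) (B t) =
     (2^-1 * (s `^ (2 * H) + t `^ (2 * H) - `|t - s| `^ (2 * H)))%:E).

(* c = c_H; for H = 1/2 the kernel does not involve c. *)
Definition fbm_constant (H c : R) : Prop :=
  0 < c /\ exists2 B : R -> wiener R -> R,
    forall t, t \in `[0, 1] ->
      is_wiener_integral P (volterra_kernel H c t) (B t) &
    fbm H B.

Definition dyadic_fbm (H c t : R) (m : nat) (w : wiener R) : R :=
  if t == 0 then 0 else
  \sum_(0 <= i < 2 ^ m)
    (2 ^+ m / t) *
    (\int[mu]_(u in `[i%:R / 2 ^+ m * t, i.+1%:R / 2 ^+ m * t])
       volterra_kernel H c t u) *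
    (w (i.+1%:R / 2 ^+ m * t) - w (i%:R / 2 ^+ m * t)).

End fractional_brownian_motion.

(* Main.v *)
Require Import Defs.
From mathcomp Require Import all_boot all_order all_algebra.
From mathcomp Require Import all_classical all_reals all_analysis.
From mathcomp Require Import measurable_realfun ring lra zify.

(** Write $\alpha = H - 1/2 \in [0, 1/2)$ and $B^{(m)} = B^{(m)}_t$. The proof has
    a deterministic part, which bounds the variances of the Gaussian variables
    $X_m = B^{(m+1)} - B^{(m)}$, and a probabilistic part, which turns geometric
    decay of these variances into convergence.

    Deterministic part. On $]0, t[$ the kernel $K(t, \cdot)$ is nonnegative, at
    most $C s^{- \alpha}$ ([volterra_kernel_le]) and nonincreasing
    ([volterra_kernel_nonincreasing]). Let $b_0 \ge b_1 \ge \dots$ be its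
    averages over the dyadic intervals of length $\delta = t 2^{-m-1}$. The
    coefficients of $B^{(m)}$ are the means $(b_{2i} + b_{2i+1})/2$, so that
    $X_m = \sum_i \frac12 (b_{2i} - b_{2i+1}) (\Delta_{2i} - \Delta_{2i+1})$ in
    terms of the increments of the path on the fine grid. Its variance is
    $\frac\delta2 \sum_i (b_{2i} - b_{2i+1})^2 \le \delta b_0^2$ by monotonicity
    ([haar_variance_le]), and $b_0 \le C' \delta^{- \alpha}$ makes this
    $O(\delta^{1 - 2\alpha})$ ([haar_variance_decay]). Monotonicity replaces any
    regularity estimate on the kernel.

    Probabilistic part. Each $X_i$ is the Wiener integral of a step function, that
    is $X_i = [h_i]$ for an explicit path $h_i$ of piecewise constant derivative;
    as the increments of the path are independent and normal, $X_i$ has Gaussian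
    exponential moments and hence $\|X_i\|_{L^q} \le C_q \sigma_i$ for all $q$
    ([wiener_increment_mgf], [subgaussian_moment]). For a functional
    $\sum_{i < n} g_i([h_i])$ with polynomials $g_i$ the $l$-th Malliavin
    derivative is $\sum_{i < n} g_i^{(l)}([h_i]) h_i^{\otimes l}$
    ([sum_sep_terms]), and $|\langle h_i, h_j \rangle| \le \sigma_i \sigma_j$
    bounds its norm by $\sum_{i < n} |g_i^{(l)}([h_i])| \sigma_i^l$
    ([tensor_norm_sep_le]). By Minkowski the partial sums form a Cauchy sequence
    as soon as the norms $\|g_i^{(l)}([h_i])\|_{L^p} \sigma_i^l$ are summable, and
    the sum of these norms bounds the Sobolev norm of the limit
    ([sobolev_norm_sep_le]).

    With $g_i(x) = \pm x$ this gives the convergence in $\mathbb{D}^p_r$ of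
    $B^{(m)}$ to its almost sure limit. With $g_i(x) = (x / \lambda_i)^2$ for
    $i \ge N$, where $\lambda_i = \eta^i$ is summable and
    $\sigma_i \le M \eta^{2i}$, it gives a function $\varphi_N \ge 0$ that is at
    least 1 almost everywhere on the open set
    $O_N = \bigcup_{i \ge N} \{|X_i| > \lambda_i\}$ and whose Sobolev norm tends to
    0 with $1/N$. Squares are used because $|X_i|$ is not smooth. Outside $O_N$
    the series $\sum_i X_i$ converges absolutely, so the set of divergence has
    capacity 0: this is the Borel-Cantelli argument for capacities. *)

Set Implicit Arguments.
Unset Strict Implicit.
Unset Printing Implicit Defensive.
Import Order.TTheory GRing.Theory Num.Theory.
Import numFieldNormedType.Exports.

Local Open Scope classical_set_scope.
Local Open Scope ring_scope.

(** * The space of paths *)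

Section wiener_space.
Context {R : realType}.

(** Uniform closeness of paths is in particular closeness at [s]. This is what
    makes the sets on which a step integral is large open. *)
Lemma continuous_wiener_val (s : R) : continuous (fun w : wiener R => w s).
Proof.
move=> w A /= nA.
have nU : nbhs (set_val w : {uniform R -> R}) [set g : R -> R | A (g s)].
  apply/uniform_nbhs => /=.
  move: nA; rewrite -nbhs_entourageE => -[E entE EA].
  exists E; split => // g /= /(_ s I) Eg; apply: EA.
  exact/xsectionP.
move: nU; rewrite nbhsE => -[V [oV Vw VA]].
exists (set_val @^-1` V); split => //=.
  by exists V.
by move=> x /= Vx; exact: (VA _ Vx).
Qed.

Lemma measurable_wiener_open (O : set (wiener R)) : open O -> measurable O.
Proof. by move=> oO; apply: sub_sigma_algebra. Qed.

Lemma measurable_wiener_continuous (f : wiener R -> R) :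
  continuous f -> measurable_fun setT f.
Proof.
move=> /continuousP cf; apply: (measurability _ (RGenOpens.measurableE R)).
move=> _ [_ [a [b ->] <-]]; rewrite setTI; apply: measurable_wiener_open.
exact/cf/interval_open.
Qed.

Lemma continuous_step_integral (f : step) : continuous (@step_integral R f).
Proof.
apply: continuous_big => [|i _ w]; first exact: add_continuous.
have cB : continuous (fun w : wiener R => w (step_hi i) - w (step_lo i)).
  by move=> v; apply: (@cvgB _ R (wiener R) (nbhs v));
    exact: continuous_wiener_val.
apply: (@cvgM R (wiener R) (nbhs w)); [exact: cvg_cst|exact: cB].
Qed.

Lemma measurable_step_integral (f : step) :
  measurable_fun setT (@step_integral R f).
Proof.
by apply: measurable_wiener_continuous; exact: continuous_step_integral.
Qed.

End wiener_space.

(** * Paths with piecewise constant derivative *)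

Section step_path.
Context {R : realType}.
Local Notation mu := (@lebesgue_measure R).
Implicit Types (f g : @step R) (a b s t : R).

Definition ramp a b s : R := Num.min s b - Num.min s a.

Lemma ramp_lipschitz a b s t : a <= b -> `|ramp a b t - ramp a b s| <= `|t - s|.
Proof.
move=> ab; rewrite /ramp !minEle.
wlog st : s t / s <= t => [H|].
  have [/H//|/ltW/H] := leP s t; by rewrite distrC (distrC t).
rewrite (ger0_norm (_ : 0 <= t - s)) ?subr_ge0// ler_norml.
by do 4!case: ifPn; rewrite -?ltNge; lra.
Qed.

Lemma continuous_ramp a b : a <= b -> continuous (ramp a b).
Proof.
move=> ab s; apply/cvgrPdist_le => e e0; near=> t.
apply: (le_trans (ramp_lipschitz _ _ ab)).
by near: t; exists e => //= t /= /ltW.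
Unshelve. all: by end_near. Qed.

Lemma is_derive_ramp a b s : a <= b -> s != a -> s != b ->
  is_derive s 1 (ramp a b) (\1_(`]a, b]) s).
Proof.
move=> ab sa sb; rewrite indicE.
have [sa'|as'] := ltP s a.
  rewrite memNset/= ?mulr0n; last by rewrite in_itv/= ltNge (ltW sa').
  apply: (@near_eq_is_derive _ _ _ (cst 0)).
  near=> t; have ta : t <= a by apply: ltW; near: t; exact: lt_nbhsl.
  by rewrite /ramp /= !min_l ?subrr// (le_trans ta).
have {as' sa}as' : a < s by rewrite lt_neqAle eq_sym sa.
have [sb'|bs'] := ltP s b.
  rewrite mem_set/= ?mulr1n; last by rewrite in_itv/= as' ltW.
  apply: (@near_eq_is_derive _ _ _ (fun t => t - a)); last first.
    rewrite -[X in is_derive _ _ _ X]subr0.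
    by apply: is_deriveB; exact: is_derive_cst.
  near=> t; have ta : a <= t by apply: ltW; near: t; exact: lt_nbhsr.
  have tb : t <= b by apply: ltW; near: t; exact: lt_nbhsl.
  by rewrite /ramp min_l ?min_r.
have {bs' sb}bs' : b < s by rewrite lt_neqAle eq_sym sb.
rewrite memNset/= ?mulr0n; last by rewrite in_itv/= (leNgt s) bs' andbF.
apply: (@near_eq_is_derive _ _ _ (cst (b - a))).
near=> t; have bt : b <= t by apply: ltW; near: t; exact: lt_nbhsr.
by rewrite /ramp !min_r// (le_trans ab).
Unshelve. all: by end_near. Qed.

Definition step_primitive f s : R :=
  \sum_(i < step_size f) step_coef i * ramp (step_lo i) (step_hi i) s.

Definition step_path_fun f s : R :=
  if s \in `[0, 1] then step_primitive f s else 0.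

Lemma step_primitive_lipschitz f s t :
  `|step_primitive f t - step_primitive f s| <=
  (\sum_(i < step_size f) `|step_coef i|) * `|t - s|.
Proof.
rewrite -sumrB mulr_suml (le_trans (ler_norm_sum _ _ _))//.
apply: ler_sum => i _; rewrite -mulrBr normrM ler_wpM2l//.
by apply: ramp_lipschitz; have [_ []] := step_le i.
Qed.

Lemma continuous_step_primitive f : continuous (step_primitive f).
Proof.
apply: continuous_big => [|i _ s]; first exact: add_continuous.
apply: cvgM; first exact: cvg_cst.
by apply: continuous_ramp; have [_ []] := step_le i.
Qed.

Lemma step_path_subproof f : @wiener_paths R (step_path_fun f).
Proof.
split; last by move=> t /negbTE t01; rewrite /step_path_fun t01.
  apply: (@subspace_eq_continuous _ _ R (step_primitive f) (step_path_fun f)).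
    by move=> s /set_mem /= s01; rewrite /step_path_fun ifT.
  exact/continuous_subspaceT/continuous_step_primitive.
rewrite /step_path_fun in_itv/= lexx ler01 /step_primitive big1// => i _.
have [lo0 [lohi _]] := step_le i.
by rewrite /ramp !min_l ?subrr ?mulr0// (le_trans lo0).
Qed.

Definition step_path f : wiener R := SigSub (mem_set (step_path_subproof f)).

Lemma step_pathE f s : step_path f s = step_path_fun f s.
Proof. by []. Qed.

Lemma step_path_ac f : absolutely_continuous01 (step_path f).
Proof.
move=> e e0; set L := \sum_(i < step_size f) `|step_coef i|.
have L0 : 0 <= L by apply: sumr_ge0.
exists (e / (L + 1)) => [|n a b ab _ sab]; first by rewrite divr_gt0 ?ltr_wpDl.
apply: (@le_lt_trans _ _ (L * \sum_i (b i - a i))).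
  rewrite mulr_sumr; apply: ler_sum => i _; have [a0 [ab' b1]] := ab i.
  rewrite !step_pathE /step_path_fun !in_itv/= a0 b1 (le_trans a0)//.
  rewrite (le_trans ab')// -(ger0_norm (_ : 0 <= b i - a i)) ?subr_ge0//.
  exact: step_primitive_lipschitz.
apply: (@le_lt_trans _ _ (L * (e / (L + 1)))).
  by rewrite ler_wpM2l// ltW.
rewrite mulrA ltr_pdivrMr ?ltr_wpDl// mulrC ltr_pM2l//; lra.
Qed.

(** The endpoints 0 and 1 are included because a path vanishes outside
    [0, 1], which may create a jump or a corner there. *)
Definition step_nodes f : set R :=
  [set 0; 1] `|` (range (@step_lo R f) `|` range (@step_hi R f)).

Lemma finite_step_nodes f : finite_set (step_nodes f).
Proof.
rewrite !finite_setU; split; first by split; exact: finite_set1.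
by split; apply: finite_image; exact: finite_finset.
Qed.

Lemma derive1_step_path f s : `[0, 1]%classic s -> ~ step_nodes f s ->
  derive1 (step_path f) s = step_fun f s.
Proof.
rewrite /= in_itv/= => /andP[s0 s1] ns.
have {}s0 : 0 < s.
  by rewrite lt_neqAle s0 andbT; apply/eqP => s0'; apply: ns; left; left.
have {}s1 : s < 1.
  by rewrite lt_neqAle s1 andbT; apply/eqP => s1'; apply: ns; left; right.
rewrite derive1E; apply: (@derive_val _ _ _ _ _ _ _ _).
apply: (@near_eq_is_derive _ _ _ (step_primitive f)).
  near=> t; rewrite step_pathE /step_path_fun in_itv/= !ltW//.
    by near: t; exact: lt_nbhsl.
  by near: t; exact: lt_nbhsr.
rewrite /step_primitive /step_fun.
rewrite (_ : (fun _ => _) = \sum_(i < step_size f)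
  (step_coef i \*: ramp (step_lo i) (step_hi i))); last first.
  by apply/funext => t; rewrite fct_sumE.
apply: is_derive_sum => i; apply: is_deriveZ.
apply: is_derive_ramp; first by have [_ []] := step_le i.
  by apply/eqP => si; apply: ns; right; left; exists i.
by apply/eqP => si; apply: ns; right; right; exists i.
Unshelve. all: by end_near. Qed.

End step_path.

Section step_cameron_martin.
Context {R : realType}.
Local Notation mu := (@lebesgue_measure R).
Local Notation I01 := (`[0, 1]%classic : set R).
Implicit Types (f g : @step R) (a b s t : R).

Lemma measurable_step_nodes f : measurable (step_nodes f).
Proof.
apply: countable_measurable => [t|]; first exact: measurable_set1.
exact/finite_set_countable/finite_step_nodes.
Qed.

Lemma step_nodes_null f : mu (step_nodes f) = 0%E.
Proof.
exact/countable_lebesgue_measure0/finite_set_countable/finite_step_nodes.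
Qed.

Lemma measurable_step_fun f : measurable_fun I01 (step_fun f).
Proof.
by apply: measurable_sum => i; exact: measurable_funM.
Qed.

Lemma step_fun_bounded f s :
  `|step_fun f s| <= \sum_(i < step_size f) `|step_coef i|.
Proof.
rewrite (le_trans (ler_norm_sum _ _ _))//; apply: ler_sum => i _.
by rewrite normrM ler_piMr// indicE ger0_norm// lern1 leq_b1.
Qed.

Lemma ae_derive1_step_path f :
  ae_eq mu I01 (derive1 (step_path f)) (step_fun f).
Proof.
exists (step_nodes f); split.
- exact: measurable_step_nodes.
- exact: step_nodes_null.
- move=> s /= H; apply: contrapT => ns; apply: H => s01.
  exact: derive1_step_path.
Qed.

(** At the nodes [derive1] takes arbitrary values, but there are finitely many
    of them, so measurability is inherited from [step_fun f]. *)
Lemma measurable_derive1_step_path f :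
  measurable_fun I01 (derive1 (step_path f)).
Proof.
have mN := measurable_step_nodes f.
rewrite -(setUIDK I01 (step_nodes f)) setUC.
apply/measurable_funU; [exact: measurableD|exact: measurableI|split].
  apply: (@eq_measurable_fun _ _ _ _ _ (step_fun f)).
    by move=> s /set_mem [s01 ns]; rewrite derive1_step_path.
  by apply: measurable_funS (measurable_step_fun f) => // s [].
move=> _ Y mY; apply: countable_measurable => [t|]; first exact: measurable_set1.
apply/finite_set_countable/(sub_finite_set _ (finite_step_nodes f)).
by move=> s [[]].
Qed.

Lemma step_energyE f :
  (\int[mu]_(s in I01) ((derive1 (step_path f) s) ^+ 2)%:E =
   \int[mu]_(s in I01) ((step_fun f s) ^+ 2)%:E)%E.
Proof.
apply: ge0_ae_eq_integral => //.
- apply/measurable_EFinP; apply: measurable_funX.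
  exact: measurable_derive1_step_path.
- by apply/measurable_EFinP; apply: measurable_funX; exact: measurable_step_fun.
- by move=> s _; rewrite lee_fin sqr_ge0.
- by move=> s _; rewrite lee_fin sqr_ge0.
- by apply: filterS (ae_derive1_step_path f) => s H /H ->.
Qed.

Lemma step_energy_fin f :
  (\int[mu]_(s in I01) ((derive1 (step_path f) s) ^+ 2)%:E < +oo)%E.
Proof.
rewrite step_energyE; set L := \sum_(i < step_size f) `|step_coef i|.
apply: (@le_lt_trans _ _ (\int[mu]_(s in I01) (cst (L ^+ 2)%:E s))%E).
  apply: ge0_le_integral => //.
  - by move=> s _; rewrite lee_fin sqr_ge0.
  - by apply/measurable_EFinP; apply: measurable_funX; exact: measurable_step_fun.
  - move=> s _; rewrite lee_fin -(real_normK (num_real _)) ler_sqr ?nnegrE//.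
      exact: step_fun_bounded.
    exact: sumr_ge0.
rewrite integral_cst//= lebesgue_measure_itv/= lte_fin ltr01.
by rewrite -EFinB -EFinM ltry.
Qed.

Definition cm_of_step f : cameron_martin R :=
  CameronMartin (@step_path_ac R f) (step_energy_fin f).

(** The constant sequence [f] is an approximating sequence, because
    [derive1 (cm_of_step f)] and [step_fun f] agree almost everywhere. *)
Lemma step_is_wiener_integral (P : probability (wiener R) R) f :
  is_wiener_integral P (derive1 (cm_of_step f)) (step_integral f).
Proof.
split; [exact: measurable_derive1_step_path|exact: measurable_step_integral|].
exists (fun=> f); split; last first.
  under eq_fun do under eq_integral do rewrite subrr expr0n/=.
  by under eq_fun do rewrite integral0; exact: cvg_cst.
rewrite (_ : (fun _ => _) = cst 0%E); first exact: cvg_cst.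
apply/funext => _ /=; rewrite -(@integral0 _ _ R mu I01).
apply: ge0_ae_eq_integral => //.
- apply/measurable_EFinP; apply: measurable_funX; apply: measurable_funB.
    exact: measurable_step_fun.
  exact: measurable_derive1_step_path.
- by move=> s _; rewrite lee_fin sqr_ge0.
- by apply: filterS (ae_derive1_step_path f) => s H /H ->; rewrite subrr expr0n.
Qed.

(** Integrate $2 |xy| \le (v/u) x^2 + (u/v) y^2$. *)
Lemma cm_inner_step_le f g (u v : R) : 0 < u -> 0 < v ->
  (\int[mu]_(s in I01) ((step_fun f s) ^+ 2)%:E <= (u ^+ 2)%:E)%E ->
  (\int[mu]_(s in I01) ((step_fun g s) ^+ 2)%:E <= (v ^+ 2)%:E)%E ->
  `|cm_inner (cm_of_step f) (cm_of_step g)| <= u * v.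
Proof.
move=> u0 v0; rewrite -!step_energyE => fu gv.
set h := derive1 (step_path f) in fu *; set k := derive1 (step_path g) in gv *.
have mh : measurable_fun I01 h by exact: measurable_derive1_step_path.
have mk : measurable_fun I01 k by exact: measurable_derive1_step_path.
have mhk : measurable_fun I01 (fun s => h s * k s) by exact: measurable_funM.
have ge0V (x y : R) : 0 < x -> 0 < y -> 0 <= y / (2 * x).
  by move=> x0 y0; rewrite divr_ge0 ?mulr_ge0// ltW.
have le : (\int[mu]_(s in I01) `|(h s * k s)%:E| <= (u * v)%:E)%E.
  apply: (@le_trans _ _ (\int[mu]_(s in I01) ((v / (2 * u))%:E * (h s ^+ 2)%:E
      + (u / (2 * v))%:E * (k s ^+ 2)%:E))%E).
    apply: ge0_le_integral => //.
    - by apply: measurableT_comp => //; exact/measurable_EFinP.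
    - by apply: emeasurable_funD; apply: emeasurable_funM => //;
        apply/measurable_EFinP; exact: measurable_funX.
    - move=> s _; rewrite -!EFinM -EFinD /abse lee_fin normrM.
      rewrite -(real_normK (num_real (h s))) -(real_normK (num_real (k s))).
      set x := `|h s|; set y := `|k s|; rewrite -subr_ge0.
      rewrite (_ : _ - _ = (v * x - u * y) ^+ 2 / (2 * u * v)); last first.
        by field; rewrite !gt_eqF.
      by rewrite divr_ge0 ?sqr_ge0// !mulr_ge0 ?ltW.
  rewrite ge0_integralD//; first last.
  - apply: emeasurable_funM => //.
    by apply/measurable_EFinP; exact: measurable_funX.
  - by move=> s _; rewrite -EFinM lee_fin mulr_ge0 ?sqr_ge0 ?ge0V.
  - apply: emeasurable_funM => //.
    by apply/measurable_EFinP; exact: measurable_funX.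
  - by move=> s _; rewrite -EFinM lee_fin mulr_ge0 ?sqr_ge0 ?ge0V.
  rewrite !ge0_integralZl_EFin//; first last.
  - exact: ge0V.
  - by apply/measurable_EFinP; exact: measurable_funX.
  - by move=> s _; rewrite lee_fin sqr_ge0.
  - exact: ge0V.
  - by apply/measurable_EFinP; exact: measurable_funX.
  - by move=> s _; rewrite lee_fin sqr_ge0.
  rewrite (_ : u * v = v / (2 * u) * u ^+ 2 + u / (2 * v) * v ^+ 2); last first.
    by field; rewrite !gt_eqF.
  by rewrite EFinD !EFinM leeD// lee_pmul// ?lee_fin ?ge0V//;
    apply: integral_ge0 => s _; rewrite lee_fin sqr_ge0.
have ihk : mu.-integrable I01 (fun s => (h s * k s)%:E).
  apply/integrableP; split; first exact/measurable_EFinP.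
  by rewrite (le_lt_trans le)// ltry.
rewrite -lee_fin (le_trans _ le)// /cm_inner.
rewrite -[X in (X <= _)%E]/(`|(fine (\int[mu]_(s in I01) (h s * k s)%:E))%:E|)%E.
rewrite fineK; last exact: integrable_fin_num.
by apply: le_abse_integral => //; exact/measurable_EFinP.
Qed.

End step_cameron_martin.

(** * Derivatives of separable polynomials *)

Section separable_polynomials.
Context {R : realType}.
Implicit Types (n l : nat) (q : {poly R}).

(** Separable polynomials. They are stable under partial derivatives, their mixed
    derivatives vanish, and with linear and quadratic [G] they provide all the
    smooth functionals that the proof needs. *)
Definition sepfun n (G : 'I_n -> {poly R}) (x : 'rV[R]_n) : R :=
  \sum_(j < n) (G j).[x 0 j].

Definition sep_partial n (i : 'I_n) (G : 'I_n -> {poly R}) (j : 'I_n) :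
  {poly R} := if j == i then (G j)^`() else 0.

(** Along a coordinate direction the difference quotient is that of the
    univariate polynomial, or zero. *)
Lemma is_derive_horner_coord n (i j : 'I_n) q (x : 'rV[R]_n) :
  is_derive x (delta_mx 0 i : 'rV[R]_n) (fun y : 'rV[R]_n => q.[y 0 j])
    (if j == i then q^`() else 0).[x 0 j].
Proof.
have shiftE (h : R) : (h *: (delta_mx 0 i : 'rV[R]_n) + x) 0 j =
    h *: ((j == i)%:R : R) + x 0 j.
  by rewrite !mxE eqxx.
have quotE : (fun h : R => h^-1 *: (((fun y : 'rV[R]_n => q.[y 0 j]) \o shift x)
      (h *: (delta_mx 0 i : 'rV[R]_n)) - q.[x 0 j])) =
    (fun h : R => h^-1 *: ((horner q \o shift (x 0 j))
      (h *: ((j == i)%:R : R)) - q.[x 0 j])).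
  by apply/funext => h /=; rewrite shiftE.
suff [D dE] : is_derive (x 0 j) ((j == i)%:R : R) (horner q)
    (if j == i then q^`() else 0).[x 0 j].
  split; first by rewrite /derivable quotE.
  by rewrite /derive quotE.
case: eqP => _; first exact: is_derive_poly.
rewrite horner0; split; first exact: derivable0.
by rewrite derive0.
Qed.

Lemma is_derive_sepfun n (i : 'I_n) (G : 'I_n -> {poly R}) (x : 'rV[R]_n) :
  is_derive x (delta_mx 0 i : 'rV[R]_n) (sepfun G) (sepfun (sep_partial i G) x).
Proof.
rewrite (_ : sepfun G = \sum_(j < n) (fun y : 'rV[R]_n => (G j).[y 0 j])).
  by apply: is_derive_sum => j; exact: is_derive_horner_coord.
by apply/funext => y; rewrite fct_sumE.
Qed.

Lemma partial_sepfun n (i : 'I_n) (G : 'I_n -> {poly R}) :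
  partial i (sepfun G) = sepfun (sep_partial i G).
Proof.
by apply/funext => x; have [_] := is_derive_sepfun i G x.
Qed.

Lemma iter_partial_sepfun n (s : seq 'I_n) (G : 'I_n -> {poly R}) :
  iter_partial s (sepfun G) = sepfun (foldr (@sep_partial n) G s).
Proof. by elim: s => //= i s ->; rewrite partial_sepfun. Qed.

Lemma continuous_sepfun n (G : 'I_n -> {poly R}) : continuous (sepfun G).
Proof.
apply: continuous_big => [|j _ x]; first exact: add_continuous.
apply: (@continuous_comp _ _ _ (fun y : 'rV[R]_n => y 0 j) (horner (G j))).
  exact: coord_continuous.
exact: continuous_horner.
Qed.

Lemma horner_growth q (y z : R) : `|y| <= z ->
  `|q.[y]| <= (\sum_(i < size q) `|q`_i|) * (1 + z) ^+ size q.
Proof.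
move=> yz; have z0 : 0 <= z by apply: le_trans yz.
rewrite horner_coef (le_trans (ler_norm_sum _ _ _))// mulr_suml.
apply: ler_sum => i _; rewrite normrM ler_wpM2l// normrX.
apply: (@le_trans _ _ ((1 + z) ^+ i)).
  by rewrite lerXn2r ?nnegrE ?addr_ge0// (le_trans yz)// lerDr.
by rewrite ler_weXn2l ?lerDl// ltnW.
Qed.

Lemma coord_le_norm n (x : 'rV[R]_n) (j : 'I_n) : `|x 0 j| <= `|x|.
Proof.
rewrite [leRHS]mx_normrE.
exact: (le_bigmax_cond _ (fun ij : 'I_1 * 'I_n => `|x ij.1 ij.2|) (j := (0, j))).
Qed.

Lemma sepfun_growth n (G : 'I_n -> {poly R}) :
  exists (C : R) (N : nat), forall x, `|sepfun G x| <= C * (1 + `|x|) ^+ N.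
Proof.
exists (\sum_j \sum_(i < size (G j)) `|(G j)`_i|), (\max_j size (G j)) => x.
rewrite (le_trans (ler_norm_sum _ _ _))// mulr_suml; apply: ler_sum => j _.
rewrite (le_trans (horner_growth _ (coord_le_norm x j)))//.
rewrite ler_wpM2l ?sumr_ge0// ler_weXn2l ?lerDl//.
by rewrite (leq_bigmax (F := fun j => size (G j))).
Qed.

Lemma smooth_sepfun n (G : 'I_n -> {poly R}) : smooth_poly_growth (sepfun G).
Proof.
move=> s; rewrite iter_partial_sepfun; split.
- exact: continuous_sepfun.
- move=> i x.
  by have [] := is_derive_sepfun i (foldr (@sep_partial n) G s) x.
- exact: sepfun_growth.
Qed.

(** [malliavin_terms] with the polynomials kept in place of the functions, so
    that sums over the terms can be computed by linearity in them. *)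
Fixpoint sep_terms n (G : 'I_n -> {poly R}) l :
    seq (('I_n -> {poly R}) * l.-tuple 'I_n) :=
  match l with
  | 0 => [:: (G, [tuple])]
  | l'.+1 => [seq (sep_partial i b.1, cons_tuple i b.2) |
               b <- sep_terms G l', i <- enum 'I_n]
  end.

Lemma malliavin_terms_sepfun n (G : 'I_n -> {poly R}) l :
  malliavin_terms (sepfun G) l = [seq (sepfun b.1, b.2) | b <- sep_terms G l].
Proof.
elim: l => //= l ->; rewrite allpairs_mapl map_allpairs.
by apply: eq_allpairs => b i; rewrite partial_sepfun.
Qed.

(** Only the pure derivatives of a separable function survive, so its $l$-th
    derivative is a sum over the diagonal. *)
Lemma sum_sep_terms n (G : 'I_n -> {poly R}) l
    (c : 'I_n -> {poly R} -> l.-tuple 'I_n -> R) :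
  (forall i u, c i 0 u = 0) ->
  \sum_(b <- sep_terms G l) \sum_i c i (b.1 i) b.2 =
  \sum_i c i (G i)^`(l) (nseq_tuple l i).
Proof.
elim: l c => [|l IH] c c0 /=.
  rewrite big_seq1; apply: eq_bigr => i _; congr (c _ _ _).
  exact: val_inj.
rewrite big_allpairs_dep/=.
transitivity (\sum_(b <- sep_terms G l)
    \sum_i (fun i q u => c i q^`() (cons_tuple i u)) i (b.1 i) b.2).
  apply: eq_bigr => b _; rewrite big_enum/=; apply: eq_bigr => i _.
  rewrite (bigD1 i)//= /sep_partial eqxx big1 ?addr0// => j /negbTE ->.
  exact: c0.
rewrite (IH (fun i q u => c i q^`() (cons_tuple i u))) => [|i u]; last first.
  by rewrite deriv0.
apply: eq_bigr => i _; rewrite -derivnS; congr (c _ _ _); exact: val_inj.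
Qed.

End separable_polynomials.

(** * Tensor norms of separable functionals *)

Section separable_functionals.
Context {R : realType}.
Variable P : probability (wiener R) R.
Implicit Types (d : nat -> @step R) (g : nat -> {poly R}) (n k l : nat).

Lemma tensor_inner_sub l (T U : tensor R l) :
  tensor_inner (tensor_sub T U) (tensor_sub T U) =
  tensor_inner T T - tensor_inner T U - (tensor_inner U T - tensor_inner U U).
Proof.
rewrite /tensor_inner /tensor_sub big_cat/= big_map/=.
under eq_bigr do rewrite big_cat/= big_map/=.
under [X in _ + X]eq_bigr do rewrite big_cat/= big_map/=.
rewrite !big_split/= -!addrA; congr (_ + _).
rewrite opprD opprK -!sumrN; congr (_ + (_ + _)).
- apply: eq_bigr => a _; rewrite -sumrN; apply: eq_bigr => b _.
  by rewrite mulrN mulNr.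
- apply: eq_bigr => a _; rewrite -sumrN; apply: eq_bigr => b _.
  by rewrite !mulNr.
- by apply: eq_bigr => a _; apply: eq_bigr => b _; rewrite mulrNN.
Qed.

(** Tensors are formal sums, which may differ and yet have the same norm. *)
Lemma eq_sobolev_gauge (p : R) r (X Y : wiener R -> R)
    (S T : forall l, wiener R -> tensor R l) :
  (forall w, `|X w| = `|Y w|) ->
  (forall l w, tensor_norm (S l w) = tensor_norm (T l w)) ->
  sobolev_gauge P p r X S = sobolev_gauge P p r Y T.
Proof.
move=> XY ST.
pose gauge (N0 : wiener R -> R) (N : nat -> wiener R -> R) :=
  ((\int[P]_w (N0 w `^ p)%:E +
    \sum_(1 <= l < r.+1) \int[P]_w (N l w `^ p)%:E) `^ p^-1)%E.
have gaugeE Z U : sobolev_gauge P p r Z U =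
    gauge (fun w => `|Z w|) (fun l w => tensor_norm (U l w)) by [].
rewrite !gaugeE; congr gauge; first exact/funext.
by apply/funext => l; apply/funext => w; rewrite ST.
Qed.

Lemma smooth_dist_sym (p : R) r (F G : smooth_functional P) :
  smooth_dist p r F G = smooth_dist p r G F.
Proof.
apply: eq_sobolev_gauge => [w|l w]; first by rewrite distrC.
rewrite /tensor_norm !tensor_inner_sub; congr Num.sqrt.
have swap (a b c e : R) : a - b - (c - e) = e - c - (b - a) by ring.
exact: swap.
Qed.

Lemma sum_sep_terms_eval n (G : 'I_n -> {poly R}) l (x : 'rV[R]_n)
    (Phi : l.-tuple 'I_n -> R) :
  \sum_(b <- sep_terms G l) sepfun b.1 x * Phi b.2 =
  \sum_i (G i)^`(l).[x 0 i] * Phi (nseq_tuple l i).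
Proof.
under eq_bigr do rewrite /sepfun mulr_suml.
rewrite (@sum_sep_terms _ _ _ _ (fun i q u => q.[x 0 i] * Phi u))// => i u.
by rewrite horner0 mul0r.
Qed.

Variables (d : nat -> @step R) (g : nat -> {poly R}).

(** The partial sums of $\sum_i g_i([h_i])$, where $h_i$ is the path of
    derivative [step_fun (d i)]. *)
Definition sep_functional n : smooth_functional P :=
  @SmoothFunctional R P n (sepfun (fun j : 'I_n => g j))
    (fun j => cm_of_step (d j)) (fun j => step_integral (d j))
    (smooth_sepfun _) (fun j => step_is_wiener_integral P (d j)).

Definition sep_coef l i (w : wiener R) : R :=
  (g i)^`(l).[step_integral (d i) w].

Lemma sm_val_sep n w : sm_val (sep_functional n) w =
  \sum_(0 <= i < n) sep_coef 0 i w.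
Proof.
rewrite big_mkord /sm_val /sm_eval /= /sepfun.
by apply: eq_bigr => i _; rewrite mxE.
Qed.

Lemma tensor_inner_sep n k l w :
  tensor_inner (malliavin (sep_functional n) l w)
               (malliavin (sep_functional k) l w) =
  \sum_(0 <= i < n) \sum_(0 <= j < k) sep_coef l i w * sep_coef l j w *
    cm_inner (cm_of_step (d i)) (cm_of_step (d j)) ^+ l.
Proof.
rewrite /tensor_inner /malliavin !malliavin_terms_sepfun -!map_comp !big_map/=.
pose x m : 'rV[R]_m := \row_(i < m) step_integral (d i) w.
pose c m m' (u : l.-tuple 'I_m) (v : l.-tuple 'I_m') := \prod_(q < l)
  cm_inner (cm_of_step (d (tnth u q))) (cm_of_step (d (tnth v q))).
have xE m (f : 'rV[R]_m -> R) :
  sm_eval (F := sep_functional m) f w = f (x m) by [].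
transitivity (\sum_(b <- sep_terms (fun j : 'I_n => g j) l)
    sepfun b.1 (x n) * (\sum_(b' <- sep_terms (fun j : 'I_k => g j) l)
    sepfun b'.1 (x k) * c n k b.2 b'.2)).
  apply: eq_bigr => b _; rewrite mulr_sumr big_map; apply: eq_bigr => b' _ /=.
  rewrite mulrA.
  rewrite (xE _ (sepfun b.1)).
  rewrite (xE _ (sepfun b'.1)).
  rewrite (_ : c n k b.2 b'.2 = \prod_(q < l) cm_inner
    (tnth (map_tuple (fun j : 'I_n => cm_of_step (d j)) b.2) q)
    (tnth (map_tuple (fun j : 'I_k => cm_of_step (d j)) b'.2) q)); last first.
  by apply: eq_bigr => q _; rewrite !tnth_map.
  reflexivity.
apply: (etrans (sum_sep_terms_eval _ _
  (fun u => \sum_(b' <- sep_terms (fun j : 'I_k => g j) l)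
    sepfun b'.1 (x k) * c n k u b'.2))).
rewrite big_mkord.
apply: eq_bigr => i _.
rewrite sum_sep_terms_eval big_mkord mulr_sumr; apply: eq_bigr => j _.
rewrite mulrA !mxE; congr (_ * _); rewrite /c.
under eq_bigr do rewrite !tnth_nseq.
by rewrite prodr_const card_ord.
Qed.

(** The terms common to the two partial sums cancel by bilinearity, although
    they remain present in the formal difference. *)
Lemma tensor_inner_sep_sub n k l w : (k <= n)%N ->
  let T m := malliavin (sep_functional m) l w in
  tensor_inner (tensor_sub (T n) (T k)) (tensor_sub (T n) (T k)) =
  \sum_(k <= i < n) \sum_(k <= j < n) sep_coef l i w * sep_coef l j w *
    cm_inner (cm_of_step (d i)) (cm_of_step (d j)) ^+ l.
Proof.
move=> kn T; rewrite tensor_inner_sub !tensor_inner_sep.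
have split2 m : forall F : nat -> nat -> R,
    \sum_(0 <= i < m) \sum_(0 <= j < n) F i j -
    \sum_(0 <= i < m) \sum_(0 <= j < k) F i j =
    \sum_(0 <= i < m) \sum_(k <= j < n) F i j.
  move=> F; rewrite -sumrB; apply: eq_bigr => i _.
  by rewrite (big_cat_nat (n := k))//= addrC addrK.
by rewrite !split2 (big_cat_nat (n := k))//= -addrA addrCA subrr addr0.
Qed.

Variable sigma : nat -> R.
Hypothesis inner_le : forall i j,
  `|cm_inner (cm_of_step (d i)) (cm_of_step (d j))| <= sigma i * sigma j.
Hypothesis sigma_ge0 : forall i, 0 <= sigma i.

Lemma tensor_norm_sep_le n k l w : (k <= n)%N ->
  tensor_norm (tensor_sub (malliavin (sep_functional n) l w)
                          (malliavin (sep_functional k) l w)) <=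
  \sum_(k <= i < n) `|sep_coef l i w| * sigma i ^+ l.
Proof.
move=> kn; set M := \sum_(k <= i < n) _.
have M0 : 0 <= M by apply: sumr_ge0 => i _; rewrite mulr_ge0 ?exprn_ge0.
rewrite -(ger0_norm M0) -sqrtr_sqr /tensor_norm ler_wsqrtr//.
rewrite tensor_inner_sep_sub// expr2 {1}/M mulr_suml.
apply: ler_sum => i _; rewrite mulr_sumr; apply: ler_sum => j _.
rewrite (le_trans (ler_norm _))// !normrM normrX mulrACA.
by rewrite ler_wpM2l ?mulr_ge0// -exprMn lerXn2r ?nnegrE ?mulr_ge0.
Qed.

End separable_functionals.

(** * Moments *)

Section moment_estimates.
Context {R : realType}.

Lemma cvge0P (u : nat -> \bar R) : (forall k, 0 <= u k)%E ->
  (forall e : R, 0 < e -> exists N, forall k, (N <= k)%N -> (u k <= e%:E)%E) ->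
  u @ \oo --> 0%E.
Proof.
move=> u0 ule; have ufin k e : (u k <= e%:E)%E -> u k \is a fin_num.
  by move=> H; rewrite ge0_fin_numE// (le_lt_trans H)// ltry.
apply/fine_cvgP; split.
  have [N uN] := ule 1 ltr01; exists N => // k /= Nk.
  exact: ufin (uN _ Nk).
apply/cvgrPdist_le => e e0; have [N uN] := ule e e0; exists N => // k /= Nk.
rewrite sub0r normrN ger0_norm ?fine_ge0// -lee_fin fineK ?uN//.
exact: ufin (uN _ Nk).
Qed.

Lemma limn_einf_le (u : nat -> \bar R) (c : \bar R) (N : nat) :
  (forall k, (N <= k)%N -> (u k <= c)%E) -> (limn_einf u <= c)%E.
Proof.
move=> uc; rewrite limn_einf_lim; apply: lime_le; first exact: is_cvg_einfs.
apply: nearW => n; apply: (@le_trans _ _ (u (maxn N n))).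
  by apply: ereal_inf_lbound; exists (maxn N n) => //=; rewrite leq_maxr.
by apply: uc; rewrite leq_maxl.
Qed.

Lemma tail_sum_lt (beta : nat -> R) (B : R) : (forall i, 0 <= beta i) ->
  (forall n, \sum_(0 <= i < n) beta i <= B) ->
  forall e : R, 0 < e -> exists N, forall k n, (N <= k)%N ->
    \sum_(k <= i < n) beta i < e.
Proof.
move=> b0 bB e e0; pose S := [set \sum_(0 <= i < n) beta i | n in [set: nat]].
have supS : has_sup S.
  split; first by exists (\sum_(0 <= i < 0) beta i); exists 0%N.
  by exists B => _ [n _ <-].
have [_ [N _ <-] SN] := sup_adherent e0 supS.
exists N => k n Nk; have [kn|nk] := leqP k n; last first.
  by rewrite big_geq// ltnW.
have mono m m' : (m <= m')%N ->
    \sum_(0 <= i < m) beta i <= \sum_(0 <= i < m') beta i.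
  by move=> mm'; rewrite [leRHS](big_cat_nat (n := m))//= lerDl sumr_ge0.
have := @sup_ubound _ S supS.2 (\sum_(0 <= i < n) beta i).
move=> /(_ (ex_intro2 _ _ n I erefl)).
rewrite (big_cat_nat (n := k))//= => H; have := mono _ _ Nk; move: SN H; lra.
Qed.

Lemma continuous_normr_powR (p : R) : 0 < p ->
  continuous (fun x : R => `|x| `^ p).
Proof.
move=> p0 x; have [->|x0] := eqVneq x 0.
  rewrite /continuous_at normr0 powR0 ?gt_eqF//; apply/cvgr0Pnorm_le => e e0.
  near=> y; rewrite ger0_norm ?powR_ge0//.
  have -> : e = (e `^ p^-1) `^ p by rewrite -powRrM mulVf ?gt_eqF// powRr1 ?ltW.
  apply: ge0_ler_powR; rewrite ?nnegrE ?powR_ge0//; first exact: ltW.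
  near: y; exists (e `^ p^-1); first by rewrite /= powR_gt0.
  by move=> y /=; rewrite sub0r normrN => /ltW.
apply: (@continuous_comp _ _ _ (fun z : R => `|z|) (fun y => y `^ p)).
  exact: norm_continuous.
apply: differentiable_continuous; apply/derivable1_diffP.
by apply: derivable_powR; rewrite in_itv/= andbT normr_gt0.
Unshelve. all: by end_near. Qed.

Context d (T : measurableType d) (P : {measure set T -> \bar R}).

Lemma measurable_comp_powR (f : T -> R) (p : R) :
  measurable_fun setT f -> measurable_fun setT (fun w => f w `^ p).
Proof. exact: (@measurableT_comp _ _ _ _ _ _ (@powR R ^~ p)). Qed.

Lemma moment_Lnorm (f : T -> R) (p : R) : 0 < p -> (forall w, 0 <= f w) ->
  (\int[P]_w (f w `^ p)%:E = 'N[P]_p%:E[EFin \o f] `^ p)%E.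
Proof.
move=> p0 f0; rewrite poweR_Lnorm; last by rewrite gt_eqF.
apply: eq_integral => w _.
by rewrite /comp abse_EFin poweR_EFin ger0_norm.
Qed.

Lemma Lnorm_le_moment (f : T -> R) (p b : R) :
  0 < p -> (forall w, 0 <= f w) -> 0 <= b ->
  (\int[P]_w (f w `^ p)%:E <= (b `^ p)%:E)%E <->
  ('N[P]_p%:E[EFin \o f] <= b%:E)%E.
Proof.
move=> p0 f0 b0; rewrite moment_Lnorm// -poweR_EFin.
have N0 : (0 <= 'N[P]_p%:E[EFin \o f])%E by exact: Lnorm_ge0.
split => [H|H]; last first.
  by apply: gt0_ler_poweR; rewrite ?in_itv/= ?leey ?andbT//; exact: ltW.
have pK (x : \bar R) : (0 <= x)%E -> ((x `^ p) `^ p^-1 = x)%E.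
  by move=> x0; rewrite -poweRrM mulfV ?gt_eqF// poweRe1.
rewrite -(pK _ N0) -(pK b%:E) ?lee_fin//.
apply: gt0_ler_poweR; rewrite ?in_itv/= ?leey ?poweR_ge0//.
  by rewrite invr_ge0 ltW.
by rewrite lee_fin powR_ge0.
Qed.

(** Minkowski's inequality, written with $p$-th powers as in the Sobolev
    gauge. *)
Lemma moment_sum_le (f : nat -> T -> R) (beta : nat -> R) (p : R) (s : seq nat) :
  1 <= p -> (forall i, measurable_fun setT (f i)) ->
  (forall i w, 0 <= f i w) -> (forall i, 0 <= beta i) ->
  (forall i, \int[P]_w (f i w `^ p)%:E <= (beta i `^ p)%:E)%E ->
  (\int[P]_w ((\sum_(i <- s) f i w) `^ p)%:E <= ((\sum_(i <- s) beta i) `^ p)%:E)%E.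
Proof.
move=> p1 mf f0 b0 fb; have p0 : 0 < p by apply: lt_le_trans p1.
apply/Lnorm_le_moment => //; [by move=> w; exact: sumr_ge0|exact: sumr_ge0|].
elim: s => [|i s IH].
  rewrite big_nil (_ : EFin \o _ = cst 0%E) ?Lnorm0// ?gt_eqF ?lte_fin//.
  by apply/funext => w /=; rewrite big_nil.
rewrite big_cons (_ : EFin \o _ = EFin \o (f i \+ (fun w => \sum_(j <- s) f j w))).
  rewrite (le_trans (minkowski_EFin _ _ _ _))//; first exact: measurable_sum.
  by rewrite EFinD leeD//; apply/Lnorm_le_moment.
by apply/funext => w /=; rewrite big_cons.
Qed.

Lemma measurable_limn_einf (f : nat -> T -> \bar R) :
  (forall n, measurable_fun setT (f n)) ->
  measurable_fun setT (fun w => limn_einf (f ^~ w)).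
Proof.
move=> mf; rewrite (_ : (fun _ => _) =
    fun w => (- limn_esup ((fun n v => - f n v) ^~ w))%E); last first.
  by apply/funext => w; rewrite -limn_einfN; congr limn_einf; apply/funext => n /=;
    rewrite oppeK.
apply: measurableT_comp => //; apply: measurable_fun_limn_esup => n.
exact: measurableT_comp.
Qed.

End moment_estimates.

(** * Sobolev norms of series of separable functionals *)

Section sobolev_series.
Context {R : realType}.
Variable P : probability (wiener R) R.
Variables (p : R) (r : nat).
Hypothesis p_gt1 : 1 < p.

Let p_gt0 : 0 < p. Proof. exact: lt_trans p_gt1. Qed.

(** The gauge is an $\ell^p$ norm of $r + 1$ numbers, each at most [S]. *)
Lemma sobolev_gauge_le (X : wiener R -> R)
    (T : forall l, wiener R -> tensor R l) (S : R) : 0 <= S ->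
  (\int[P]_w (`|X w| `^ p)%:E <= (S `^ p)%:E)%E ->
  (forall l, (l <= r)%N ->
    (\int[P]_w (tensor_norm (T l w) `^ p)%:E <= (S `^ p)%:E)%E) ->
  (sobolev_gauge P p r X T <= ((r.+1)%:R `^ p^-1 * S)%:E)%E.
Proof.
move=> S0 XS TS; rewrite /sobolev_gauge.
have -> : r.+1%:R `^ p^-1 * S = (r.+1%:R * S `^ p) `^ p^-1.
  by rewrite powRM ?powR_ge0 ?ler0n// -powRrM mulfV ?gt_eqF// powRr1.
rewrite -poweR_EFin; apply: gt0_ler_poweR.
- by rewrite invr_ge0 ltW.
- rewrite in_itv/= leey andbT adde_ge0//.
    by apply: integral_ge0 => w _; rewrite lee_fin powR_ge0.
  apply: sume_ge0 => l _.
  by apply: integral_ge0 => w _; rewrite lee_fin powR_ge0.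
- by rewrite in_itv/= leey lee_fin mulr_ge0 ?powR_ge0.
rewrite -natr1 mulrDl mul1r addrC EFinD; apply: leeD => //.
have -> : ((r%:R * S `^ p)%:E = \sum_(1 <= l < r.+1) (S `^ p)%:E)%E.
  by rewrite sumEFin sumr_const_nat subn1 /= mulr_natl.
rewrite big_seq [leRHS]big_seq; apply: lee_sum => l.
by rewrite mem_index_iota ltnS => /andP[_ lr]; exact: TS.
Qed.

Variables (d : nat -> @step R) (g : nat -> {poly R}) (sigma beta : nat -> R).
Variable B : R.
Hypothesis inner_le : forall i j,
  `|cm_inner (cm_of_step (d i)) (cm_of_step (d j))| <= sigma i * sigma j.
Hypothesis sigma_ge0 : forall i, 0 <= sigma i.
Hypothesis beta_ge0 : forall i, 0 <= beta i.
Hypothesis moment_le : forall i l, (l <= r)%N ->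
  (\int[P]_w ((`|sep_coef d g l i w| * sigma i ^+ l) `^ p)%:E <=
   (beta i `^ p)%:E)%E.
Hypothesis beta_le : forall n, \sum_(0 <= i < n) beta i <= B.

Let F := sep_functional P d g.
Let K : R := r.+1%:R `^ p^-1.

Lemma measurable_sep_coef l i : measurable_fun setT (sep_coef d g l i).
Proof.
apply: (@measurableT_comp _ _ _ _ _ _ (horner (g i)^`(l))).
  by apply: continuous_measurable_fun; exact: continuous_horner.
exact: measurable_step_integral.
Qed.

Lemma measurable_sep_val n : measurable_fun setT (sm_val (F n)).
Proof.
rewrite (_ : sm_val (F n) = fun w => \sum_(0 <= i < n) sep_coef d g 0 i w).
  by apply: measurable_sum => i; exact: measurable_sep_coef.
by apply/funext => w; rewrite sm_val_sep.
Qed.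

Lemma measurable_tensor_norm_sep_sub n k l : (k <= n)%N ->
  measurable_fun setT (fun w =>
    tensor_norm (tensor_sub (malliavin (F n) l w) (malliavin (F k) l w))).
Proof.
move=> kn; rewrite /tensor_norm.
under eq_fun do rewrite tensor_inner_sep_sub//.
apply: (@measurableT_comp _ _ _ _ _ _ (@Num.sqrt R)).
  by apply: continuous_measurable_fun; exact: sqrt_continuous.
apply: measurable_sum => i; apply: measurable_sum => j.
by apply: measurable_funM => //; apply: measurable_funM;
  exact: measurable_sep_coef.
Qed.

Lemma sep_moment_sum_le k n l : (l <= r)%N ->
  (\int[P]_w ((\sum_(k <= i < n) `|sep_coef d g l i w| * sigma i ^+ l) `^ p)%:E
    <= ((\sum_(k <= i < n) beta i) `^ p)%:E)%E.
Proof.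
move=> lr; apply: moment_sum_le => //; first exact: ltW.
- move=> i; apply: measurable_funM => //; apply: measurableT_comp => //.
  exact: measurable_sep_coef.
- by move=> i w; rewrite mulr_ge0 ?exprn_ge0.
- by move=> i; exact: moment_le.
Qed.

Lemma measurable_sep_sum k n l : measurable_fun setT (fun w =>
  (\sum_(k <= i < n) `|sep_coef d g l i w| * sigma i ^+ l) `^ p).
Proof.
apply: measurable_comp_powR.
apply: measurable_sum => i; apply: measurable_funM => //.
by apply: measurableT_comp => //; exact: measurable_sep_coef.
Qed.

Lemma sep_val_moment_le k n : (k <= n)%N ->
  (\int[P]_w (`|sm_val (F n) w - sm_val (F k) w| `^ p)%:E <=
   ((\sum_(k <= i < n) beta i) `^ p)%:E)%E.
Proof.
move=> kn; apply: le_trans (sep_moment_sum_le k n (leq0n r)).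
apply: ge0_le_integral => //.
- apply/measurable_EFinP/measurable_comp_powR.
  by apply: measurableT_comp => //; apply: measurable_funB;
    exact: measurable_sep_val.
- by apply/measurable_EFinP; exact: measurable_sep_sum.
- move=> w _; rewrite lee_fin; apply: ge0_ler_powR; rewrite ?nnegrE//.
  + exact: ltW.
  + by apply: sumr_ge0 => i _; rewrite mulr_ge0.
  + rewrite !sm_val_sep (big_cat_nat (n := k))//= addrAC subrr add0r.
    rewrite (le_trans (ler_norm_sum _ _ _))//; apply: ler_sum => i _.
    by rewrite expr0 mulr1.
Qed.

(** The triangle inequality for the Sobolev norm of a partial sum: in each
    order of differentiation the norm of a sum is at most the sum of the norms
    of its terms, hence at most the corresponding sum of [beta]. *)
Lemma sep_dist_le k n : (k <= n)%N ->
  (smooth_dist p r (F n) (F k) <= (K * \sum_(k <= i < n) beta i)%:E)%E.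
Proof.
move=> kn; apply: sobolev_gauge_le => [||l lr]; first exact: sumr_ge0.
  exact: sep_val_moment_le.
apply: le_trans (sep_moment_sum_le k n lr); apply: ge0_le_integral => //.
- by move=> w _; rewrite lee_fin powR_ge0.
- apply/measurable_EFinP/measurable_comp_powR.
  exact: measurable_tensor_norm_sep_sub.
- by apply/measurable_EFinP; exact: measurable_sep_sum.
- move=> w _; rewrite lee_fin; apply: ge0_ler_powR; rewrite ?nnegrE//.
  + exact: ltW.
  + exact: sqrtr_ge0.
  + by apply: sumr_ge0 => i _; rewrite mulr_ge0 ?exprn_ge0.
  + exact: tensor_norm_sep_le.
Qed.

Lemma sep_norm_le n :
  (smooth_norm p r (F n) <= (K * \sum_(0 <= i < n) beta i)%:E)%E.
Proof.
apply: le_trans (sep_dist_le (leq0n n)).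
rewrite /smooth_norm /smooth_dist.
rewrite (eq_sobolev_gauge P p r (Y := fun w => sm_val (F n) w - sm_val (F 0%N) w)
  (T := fun l w => tensor_sub (malliavin (F n) l w) (malliavin (F 0%N) l w)))//.
  by move=> w; rewrite (sm_val_sep _ _ _ 0%N) big_geq// subr0.
move=> l w; rewrite /tensor_norm; congr Num.sqrt.
by rewrite tensor_inner_sep_sub// tensor_inner_sep.
Qed.

Let K_gt0 : 0 < K. Proof. by rewrite powR_gt0. Qed.

Lemma sep_cauchy (e : R) : 0 < e -> exists N, forall j k, (N <= j)%N ->
  (N <= k)%N -> (smooth_dist p r (F j) (F k) < e%:E)%E.
Proof.
move=> e0; have [N SN] := tail_sum_lt beta_ge0 beta_le (divr_gt0 e0 K_gt0).
exists N => j k; wlog kj : j k / (k <= j)%N => [H Nj Nk|Nj Nk].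
  have [/H|/ltnW/H] := leqP k j; first exact.
  by rewrite smooth_dist_sym; exact.
rewrite (le_lt_trans (sep_dist_le kj))// lte_fin mulrC -ltr_pdivlMr//.
exact: SN.
Qed.

(** Fatou's lemma turns the almost everywhere limit into an $L^p$ limit. *)
Lemma sep_cvg_Lp (Y : wiener R -> R) : measurable_fun setT Y ->
  {ae P, forall w, sm_val (F n) w @[n --> \oo] --> Y w} ->
  (fun k => \int[P]_w (`|sm_val (F k) w - Y w| `^ p)%:E)%E @ \oo --> 0%E.
Proof.
move=> mY VY; apply: cvge0P => [k|e e0].
  by apply: integral_ge0 => w _; rewrite lee_fin powR_ge0.
have ep0 : 0 < e `^ p^-1 by rewrite powR_gt0.
have [N SN] := tail_sum_lt beta_ge0 beta_le ep0.
exists N => k Nk.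
pose h (j : nat) w := (`|sm_val (F k) w - sm_val (F j) w| `^ p)%:E.
have mh j : measurable_fun setT (h j).
  apply/measurable_EFinP/measurable_comp_powR/measurableT_comp => //.
  by apply: measurable_funB; exact: measurable_sep_val.
apply: (@le_trans _ _ (\int[P]_w limn_einf (h ^~ w))%E).
  apply: ae_ge0_le_integral => //.
  - apply/measurable_EFinP/measurable_comp_powR/measurableT_comp => //.
    by apply: measurable_funB => //; exact: measurable_sep_val.
  - move=> w _; rewrite limn_einf_lim; apply: lime_ge; first exact: is_cvg_einfs.
    apply: nearW => n; apply: le_ereal_inf_tmp => _ [m _ <-].
    by rewrite lee_fin powR_ge0.
  - exact: measurable_limn_einf.
  - apply: filterS VY => w VY _.
    have hY : h j w @[j --> \oo] --> (`|sm_val (F k) w - Y w| `^ p)%:E.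
      apply: cvg_EFin; first exact: nearW.
      apply: (@continuous_cvg _ _ _ _ _
        (fun j => sm_val (F k) w - sm_val (F j) w) (fun x : R => `|x| `^ p)).
        exact: continuous_normr_powR.
      by apply: cvgB => //; exact: cvg_cst.
    by have [-> _] := cvg_limn_einf_sup hY.
apply: (@le_trans _ _ (limn_einf (fun j => \int[P]_w h j w))%E).
  by apply: fatou => // j w _; rewrite lee_fin powR_ge0.
apply: (@limn_einf_le _ _ _ k) => j kj.
rewrite /h; under eq_integral do rewrite distrC.
rewrite (le_trans (sep_val_moment_le kj))// lee_fin.
have -> : e = (e `^ p^-1) `^ p.
  by rewrite -powRrM mulVf ?gt_eqF// powRr1 ?ltW.
apply: ge0_ler_powR; rewrite ?nnegrE ?sumr_ge0 ?powR_ge0//; first exact: ltW.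
exact/ltW/SN.
Qed.

Lemma sep_approx_subseq (Y : wiener R -> R) (s : nat -> nat) :
  (forall k, (k <= s k)%N) -> measurable_fun setT Y ->
  {ae P, forall w, sm_val (F n) w @[n --> \oo] --> Y w} ->
  sobolev_approx p r (F \o s) Y.
Proof.
move=> ks mY VY; split=> //.
  move=> e /sep_cauchy[N HN]; exists N => j k Nj Nk /=.
  by apply: HN; [exact: leq_trans (ks j)|exact: leq_trans (ks k)].
have s_oo : s k @[k --> \oo] --> \oo.
  move=> A [N _ NA]; exists N => // k /= Nk.
  by apply: NA => /=; exact: leq_trans (ks k).
exact: (cvg_comp _ _ s_oo (sep_cvg_Lp mY VY)).
Qed.

(** The norms of the partial sums need not converge, but they are bounded, so
    along a subsequence they converge to a value that bounds the norm of the
    limit. *)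
Lemma sobolev_norm_sep_le (Y : wiener R -> R) : measurable_fun setT Y ->
  {ae P, forall w, sm_val (F n) w @[n --> \oo] --> Y w} ->
  (sobolev_norm P p r Y <= (K * B)%:E)%E.
Proof.
move=> mY VY.
have leB n : (smooth_norm p r (F n) <= (K * B)%:E)%E.
  by rewrite (le_trans (sep_norm_le n))// lee_fin ler_pM2l.
have ge0 n : (0 <= smooth_norm p r (F n))%E by exact: poweR_ge0.
have fin n : smooth_norm p r (F n) \is a fin_num.
  by rewrite ge0_fin_numE// (le_lt_trans (leB n))// ltry.
pose u n := fine (smooth_norm p r (F n)).
have uB n : u n <= K * B by rewrite -lee_fin fineK.
have u0 n : 0 <= u n by exact: fine_ge0.
have bu : bounded_fun u.
  exists (K * B); split => [|x Bx n _ /=]; first exact: num_real.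
  by rewrite ger0_norm// (le_trans (uB n))// ltW.
have [s incs cvs] := bolzano_weierstrass bu.
have ks k : (k <= s k)%N.
  elim: k => // k IH; apply: leq_ltn_trans IH _.
  by rewrite ltnNge; have := incs k.+1 k; rewrite leEnat => ->; rewrite ltnn.
have us0 : lim (u \o s @ \oo) <= K * B.
  by apply: limr_le => //; apply: nearW => n; exact: uB.
apply: (@le_trans _ _ (lim (u \o s @ \oo))%:E); last by rewrite lee_fin.
apply: ereal_inf_lbound; exists (F \o s); first exact: sep_approx_subseq.
apply: (@cvg_trans _ (EFin \o (u \o s) @ \oo)).
  by apply: near_eq_cvg; apply: nearW => n /=; rewrite fineK.
by apply: cvg_EFin => //; exact: nearW.
Qed.

Lemma sobolev_sep (Y : wiener R -> R) : measurable_fun setT Y ->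
  {ae P, forall w, sm_val (F n) w @[n --> \oo] --> Y w} ->
  sobolev P p r Y.
Proof. by move=> mY VY; exists F; exact: (@sep_approx_subseq _ id). Qed.

End sobolev_series.

(** * Almost everywhere convergence *)

Section ae_convergence.
Context {R : realType} d (T : measurableType d) (P : {measure set T -> \bar R}).

(** A series whose terms have summable $L^p$ norms converges almost
    everywhere: by monotone convergence its series of absolute values is in
    $L^p$. *)
Lemma ae_cvg_sum (f : nat -> T -> R) (beta : nat -> R) (p B : R) : 1 <= p ->
  (forall i, measurable_fun setT (f i)) -> (forall i, 0 <= beta i) ->
  (forall i, \int[P]_w (`|f i w| `^ p)%:E <= (beta i `^ p)%:E)%E ->
  (forall n, \sum_(0 <= i < n) beta i <= B) ->
  {ae P, forall w, cvgn (fun n => \sum_(0 <= i < n) f i w)}.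
Proof.
move=> p1 mf b0 fb bB; have p0 : 0 < p by apply: lt_le_trans p1.
pose S n w := \sum_(0 <= i < n) `|f i w|.
have S0 n w : 0 <= S n w by exact: sumr_ge0.
have mS n : measurable_fun setT (S n).
  by apply: measurable_sum => i; exact: measurableT_comp.
have homoS w n m : (n <= m)%N -> S n w <= S m w.
  by move=> nm; rewrite /S [leRHS](big_cat_nat (n := n))//= lerDl sumr_ge0.
pose G n w := (S n w `^ p)%:E.
have mG n : measurable_fun setT (G n).
  by apply/measurable_EFinP/measurable_comp_powR.
have G0 n w : setT w -> (0 <= G n w)%E by move=> _; rewrite lee_fin powR_ge0.
have ndG w : setT w -> {homo G^~ w : n m / (n <= m)%N >-> (n <= m)%E}.
  move=> _ n m nm; rewrite lee_fin; apply: ge0_ler_powR; rewrite ?nnegrE//.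
    exact: ltW.
  exact: homoS.
have cG w : cvgn (G ^~ w).
  by apply: ereal_nondecreasing_is_cvgn => n m nm; exact: ndG.
have B0 : 0 <= B by apply: le_trans (bB 0%N); rewrite big_geq.
have intG : (\int[P]_w limn (G ^~ w) <= (B `^ p)%:E)%E.
  rewrite monotone_convergence//; apply: lime_le.
    apply: ereal_nondecreasing_is_cvgn => n m nm.
    by apply: ge0_le_integral => // w _; [exact: (G0 n w I)|exact: (ndG w I)].
  apply: nearW => n; rewrite /G.
  apply: (le_trans (moment_sum_le _ p1 _ _ b0 fb)) => //.
    by move=> i; exact: measurableT_comp.
  rewrite lee_fin; apply: ge0_ler_powR; rewrite ?nnegrE ?sumr_ge0//.
  exact: ltW.
have limG0 w : (0 <= limn (G ^~ w))%E.
  by apply: lime_ge => //; apply: nearW => n; exact: (G0 n w I).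
have iG : P.-integrable setT (fun w => limn (G ^~ w)).
  apply/integrableP; split.
    rewrite (_ : (fun _ => _) = fun w => limn_esup (G ^~ w)).
      exact: measurable_fun_limn_esup.
    by apply/funext => w; rewrite is_cvg_limn_esupE.
  under eq_integral do rewrite gee0_abs//.
  by rewrite (le_lt_trans intG)// ltry.
apply: filterS (integrable_ae measurableT iG) => w /(_ I) Gfin.
apply: normed_cvg; apply: nondecreasing_is_cvgn.
  move=> n m nm; rewrite /series/=.
  exact: homoS.
exists (fine (limn (G ^~ w)) `^ p^-1) => _ [n _ <-].
rewrite -[leLHS](_ : (S n w `^ p) `^ p^-1 = _); last first.
  by rewrite -powRrM mulfV ?gt_eqF// powRr1.
apply: ge0_ler_powR; rewrite ?nnegrE ?powR_ge0 ?fine_ge0//.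
  by rewrite invr_ge0 ltW.
rewrite -lee_fin fineK//; apply: lime_ge => //.
by exists n => // m /= nm; exact: ndG.
Qed.

(** The upper limit, made real: a measurable function that is the limit wherever
    there is one. *)
Definition ae_limit (V : nat -> T -> R) (w : T) : R :=
  fine (limn_esup (fun n => (V n w)%:E)).

Lemma measurable_ae_limit (V : nat -> T -> R) :
  (forall n, measurable_fun setT (V n)) -> measurable_fun setT (ae_limit V).
Proof.
move=> mV; apply: (@measurableT_comp _ _ _ _ _ _ (@fine R)) => //.
by apply: measurable_fun_limn_esup => n; exact/measurable_EFinP.
Qed.

Lemma cvg_ae_limit (V : nat -> T -> R) w : cvgn (V ^~ w) ->
  V n w @[n --> \oo] --> ae_limit V w.
Proof.
move=> /cvg_ex[l Vl]; suff -> : ae_limit V w = l by [].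
have El : (fun n => (V n w)%:E) @ \oo --> l%:E.
  by apply: cvg_EFin => //; exact: nearW.
by rewrite /ae_limit; have [_ ->] := cvg_limn_einf_sup El.
Qed.

End ae_convergence.

(** * Integrals against densities and independence *)

Section density_transfer.
Context {R : realType} d1 d2 (X : measurableType d1) (Y : measurableType d2).
Variables (mu : {measure set X -> \bar R}) (nu : {measure set Y -> \bar R}).
Variables (phi : X -> Y) (G : X -> R) (e : R).
Hypothesis mphi : measurable_fun setT phi.
Hypothesis mG : measurable_fun setT G.
Hypothesis G0 : forall x, 0 <= G x.
Hypothesis on_sets : forall A, measurable A ->
  (\int[mu]_x (G x * \1_A (phi x))%:E = e%:E * nu A)%E.

Import HBNNSimple.

Let measurable_comp_phi (f : Y -> R) : measurable_fun setT f ->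
  measurable_fun setT (fun x => (G x * f (phi x))%:E).
Proof.
move=> mf; apply/measurable_EFinP; apply: measurable_funM => //.
exact: (@measurableT_comp _ _ _ _ _ _ f _ phi).
Qed.

Lemma transfer_nnsfun (h : {nnsfun Y >-> R}) :
  (\int[mu]_x (G x * h (phi x))%:E = e%:E * \int[nu]_y (h y)%:E)%E.
Proof.
have mA r : measurable (h @^-1` [set r]) by [].
pose F r x := (G x * (r * \1_(h @^-1` [set r]) (phi x)))%:E.
have F0 r x : (0 <= F r x)%E.
  by rewrite lee_fin mulr_ge0//; have := nnfun_muleindic_ge0 h r (phi x); rewrite lee_fin.
have mF r : measurable_fun setT (F r).
  apply: (measurable_comp_phi (f := fun y => r * \1_(h @^-1` [set r]) y)).
  exact: measurable_funM.
transitivity (\int[mu]_x (\sum_(r \in range h) F r x))%E.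
  apply: eq_integral => x _; rewrite [in LHS](fimfunE h) fsumEFin//.
  by congr EFin; rewrite mulr_fsumr.
rewrite ge0_integral_fsum// integralT_nnsfun sintegralE ge0_mule_fsumr; last first.
  by move=> r; rewrite nnsfun_mulemu_ge0.
apply: eq_fsbigr => r _; have [r0|r0] := leP 0 r; last first.
  rewrite preimage_nnfun0// measure0 mule0 mule0.
  rewrite (_ : F r = cst 0%E) ?integral0//; apply/funext => x.
  by rewrite /F preimage_nnfun0// indic0 mulr0 mulr0.
rewrite muleCA -on_sets// -ge0_integralZl_EFin//.
- by apply: eq_integral => x _; rewrite /F -EFinM mulrCA.
- by move=> x _; rewrite lee_fin mulr_ge0.
- exact: measurable_comp_phi.
Qed.

(** Approximation by simple functions. With [phi] the identity this computes
    integrals against a density; with [phi] a random variable independent of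
    [G] it factors an expectation. *)
Lemma transfer_integral (f : Y -> R) : measurable_fun setT f ->
  (forall y, 0 <= f y) ->
  (\int[mu]_x (G x * f (phi x))%:E = e%:E * \int[nu]_y (f y)%:E)%E.
Proof.
move=> mf f0; have mf' : measurable_fun setT (EFin \o f) by exact/measurable_EFinP.
pose f_ := nnsfun_approx measurableT mf'.
have cf y : (f_ n y)%:E @[n --> \oo] --> (f y)%:E.
  by apply: (cvg_nnsfun_approx measurableT mf') => // z _; rewrite lee_fin.
have nd y a b : (a <= b)%N -> f_ a y <= f_ b y.
  by move=> ab; exact/lefP/nd_nnsfun_approx.
transitivity (limn (fun n => \int[mu]_x (G x * f_ n (phi x))%:E)%E).
  rewrite -monotone_convergence//.
  - apply: eq_integral => x _; apply/esym/cvg_lim => //.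
    under eq_fun do rewrite EFinM.
    by rewrite EFinM; apply: cvgeZl => //; exact: cf.
  - by move=> n; exact: measurable_comp_phi.
  - by move=> n x _; rewrite lee_fin mulr_ge0.
  - by move=> x _ a b ab; rewrite lee_fin ler_wpM2l// nd.
rewrite (_ : \int[nu]_y _ = limn (fun n => \int[nu]_y (f_ n y)%:E))%E; last first.
  rewrite -monotone_convergence//.
  - by apply: eq_integral => y _; apply/esym/cvg_lim => //; exact: cf.
  - by move=> n; exact/measurable_EFinP.
  - by move=> n y _; rewrite lee_fin.
  - by move=> y _ a b ab; rewrite lee_fin nd.
rewrite -limeMl//.
  by congr (limn _); apply/funext => n; rewrite transfer_nnsfun.
apply/ereal_nondecreasing_is_cvgn => a b ab; apply: ge0_le_integral => //.
- by move=> y _; rewrite lee_fin.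
- exact/measurable_EFinP.
- exact/measurable_EFinP.
- by move=> y _; rewrite lee_fin nd.
Qed.

End density_transfer.

Section independence.
Context {R : realType} d (T : measurableType d) (P : probability T R).
Variables (n : nat) (D : nat -> T -> R).
Variable N : nat -> probability (measurableTypeR R) R.
Hypothesis mD : forall i, measurable_fun setT (D i).
Hypothesis indep : forall A : nat -> set R, (forall i, measurable (A i)) ->
  P [set w | forall i, (i < n)%N -> A i (D i w)] =
  (\prod_(0 <= i < n) N i (A i))%E.

Let prod_indic (A : nat -> set R) w :
  \prod_(i < n) \1_(A i) (D i w) =
  \1_[set w | forall i, (i < n)%N -> A i (D i w)] w :> R.
Proof.
rewrite indicE; have [/set_mem/= H|/negP H] := boolP (w \in _).
  by rewrite big1// => i _; rewrite indicE mem_set//; exact: H.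
have [i Ai] : exists i : 'I_n, ~ A i (D i w).
  apply: contrapT => /forallNP H'; apply: H; apply: mem_set => i ltin /=.
  by have /contrapT := H' (Ordinal ltin).
by rewrite (bigD1 i)//= indicE memNset// mul0r.
Qed.

Let mpreim (A : nat -> set R) : (forall i, measurable (A i)) ->
  measurable [set w | forall i, (i < n)%N -> A i (D i w)].
Proof.
move=> mA; rewrite (_ : mkset _ =
    \bigcap_(i in [set i | (i < n)%N]) (D i @^-1` A i)) //.
apply: bigcap_measurableType => i _.
by rewrite -[X in measurable X]setTI; exact: mD.
Qed.

(** Replacing, one coordinate at a time, indicators by arbitrary nonnegative
    functions. *)
Let indep_expectation_upto (k : nat) : (k <= n)%N ->
  forall (f : nat -> R -> R) (m : nat -> R),
  (forall i, measurable_fun setT (f i)) -> (forall i x, 0 <= f i x) ->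
  (forall i, (\int[N i]_x (f i x)%:E = (m i)%:E)%E) ->
  (forall i, (k <= i < n)%N -> exists2 A, measurable A & f i = \1_A) ->
  (\int[P]_w (\prod_(i < n) f i (D i w))%:E = (\prod_(i < n) m i)%:E)%E.
Proof.
elim: k => [_|k IH kn] f m mf f0 fm fA.
  have /choice[A] : forall i, exists A, measurable A /\ ((i < n)%N -> f i = \1_A).
    move=> i; have [ltin|] := ltnP i n; last by exists setT.
    by have [A mA ->] := fA i ltin; exists A.
  move=> /all_and2[mA fE].
  rewrite (eq_integral (fun w => (\1_[set w | forall i, (i < n)%N ->
      A i (D i w)] w)%:E)); last first.
    by move=> w _; rewrite -prod_indic; congr EFin; apply: eq_bigr => i _; rewrite fE.
  rewrite integral_indic//; last exact: mpreim.
  rewrite setIT; apply: (etrans (indep mA)).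
  rewrite big_mkord -prodEFin; apply: eq_bigr => i _.
  by rewrite -fm fE// integral_indic ?setIT//; exact: mA.
pose k0 := Ordinal kn.
pose G w := \prod_(i < n | i != k0) f i (D i w).
pose e := \prod_(i < n | i != k0) m i.
have mfD i : measurable_fun setT (fun w => f i (D i w)).
  exact: (@measurableT_comp _ _ _ _ _ _ (f i) _ (D i)).
have mG : measurable_fun setT G.
  rewrite (_ : G = fun w => \prod_(i < n) if i != k0 then f i (D i w) else 1).
    by apply: measurable_prod => i _; case: (i != k0) => //; exact: mfD.
  by apply/funext => w; rewrite /G big_mkcond.
have G0 w : 0 <= G w by apply: prodr_ge0 => i _.
have onA A : measurable A ->
    (\int[P]_w (G w * \1_A (D k w))%:E = e%:E * N k A)%E.
  move=> mA; have finA : N k A \is a fin_num by exact: fin_num_measure.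
  pose f' i := if i == k then \1_A else f i.
  pose m' i := if i == k then fine (N k A) else m i.
  have := IH (ltnW kn) f' m'; rewrite /f' /m' => IHk.
  rewrite -[N k A]fineK// -EFinM mulrC.
  transitivity ((\prod_(i < n) m' i)%:E); last first.
    rewrite (bigD1 k0)//= /m' eqxx; congr (_ * _)%:E.
    by apply: eq_bigr => i ik; rewrite ifN.
  rewrite -IHk.
  - apply: eq_integral => w _; congr EFin.
    rewrite (bigD1 k0)//= eqxx mulrC; congr (_ * _).
    by apply: eq_bigr => i ik; rewrite ifN.
  - by move=> i; case: ifP => // _; exact: measurable_indic.
  - by move=> i x; case: ifP.
  - move=> i; case: eqP => [->|_]; last exact: fm.
    by rewrite integral_indic// setIT fineK.
  - move=> i /andP[ki ltin]; case: eqP => [_|/eqP ik]; first by exists A.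
    by apply: fA; rewrite ltin ltn_neqAle eq_sym ik ki.
have := @transfer_integral R _ _ T (measurableTypeR R) P (N k) (D k) G e
  (mD k) mG G0 onA (f k) (mf k) (f0 k).
rewrite fm -EFinM => H; rewrite (bigD1 k0)//= mulrC -H.
by apply: eq_integral => w _; rewrite (bigD1 k0)//= mulrC.
Qed.

Lemma indep_expectation (f : nat -> R -> R) (m : nat -> R) :
  (forall i, measurable_fun setT (f i)) -> (forall i x, 0 <= f i x) ->
  (forall i, (\int[N i]_x (f i x)%:E = (m i)%:E)%E) ->
  (\int[P]_w (\prod_(i < n) f i (D i w))%:E = (\prod_(i < n) m i)%:E)%E.
Proof.
move=> mf f0 fm.
apply: (indep_expectation_upto (leqnn n)) => // i /andP[].
by rewrite leqNgt => /negP.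
Qed.

End independence.

(** * Moments of Wiener integrals of step functions *)

Section gaussian_moments.
Context {R : realType}.

(** Completing the square turns the exponentially tilted density into the
    density centred at $a s^2$. *)
Lemma normal_mgf (a s : R) : s != 0 ->
  (\int[normal_prob 0 s]_x (expR (a * x))%:E =
   (expR (a ^+ 2 * s ^+ 2 / 2))%:E)%E.
Proof.
move=> s0; set c := expR _.
have mE : measurable_fun setT (fun x : R => expR (a * x)).
  by apply: measurableT_comp => //; exact: measurable_funM.
have := @transfer_integral R _ _ (measurableTypeR R) (measurableTypeR R)
  lebesgue_measure (normal_prob 0 s) id (normal_pdf 0 s) 1
  (@measurable_id _ _ _) (measurable_normal_pdf 0 s) (normal_pdf_ge0 0 s).
move=> /(_ _ _ mE (fun x => expR_ge0 _)); rewrite mul1e => <-; last first.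
  move=> A mA; rewrite mul1e /normal_prob [RHS]integral_mkcond.
  apply: eq_integral => x _; rewrite patchE indicE.
  by case: ifP => xA; rewrite /= ?mulr1 ?mulr0.
transitivity (\int[lebesgue_measure]_x
    (c%:E * (normal_pdf (a * s ^+ 2) s x)%:E))%E.
  apply: eq_integral => x _; rewrite -EFinM !normal_pdfE//; congr EFin.
  rewrite /normal_fun mulrCA -mulrA; congr (_ * _).
  rewrite /c -!expRD; congr expR; rewrite subr0.
  by field.
rewrite ge0_integralZl_EFin ?expR_ge0//.
- by rewrite integral_normal_pdf mule1.
- by move=> x _; rewrite lee_fin normal_pdf_ge0.
- by apply/measurable_EFinP; exact: measurable_normal_pdf.
Qed.

Lemma powR_le_cosh (q : R) : 0 < q -> exists2 C : R, 0 < C &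
  forall x, `|x| `^ q <= C * (expR x + expR (- x)).
Proof.
move=> q0; pose N := (Num.truncn q).+1.
have qN : q <= N%:R by rewrite ltW// truncnS_gt.
exists (1 + N`!%:R) => [|x]; first by rewrite ltr_pwDl// ler0n.
apply: (@le_trans _ _ (1 + `|x| ^+ N)).
  have [x1|x1] := leP `|x| 1.
    rewrite (@le_trans _ _ 1) ?lerDl ?exprn_ge0//.
    apply: (@le_trans _ _ (1 `^ q)); last by rewrite powR1.
    by apply: ge0_ler_powR; rewrite ?nnegrE// ltW.
  rewrite (@le_trans _ _ (`|x| ^+ N)) ?lerDr//.
  by rewrite -powR_mulrn// ler_powR// ltW.
have ex : `|x| ^+ N <= N`!%:R * expR `|x|.
  rewrite mulrC -ler_pdivrMr ?ltr0n ?fact_gt0//.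
  by have := expR_ge1Dxn (Num.truncn q) (normr_ge0 x); apply: le_trans; rewrite lerDr.
have e1 : 1 <= expR `|x| by rewrite -expR0 ler_expR.
have ee : expR `|x| <= expR x + expR (- x).
  by have [x0|x0] := leP 0 x; [rewrite ger0_norm// lerDl|rewrite ltr0_norm// lerDr];
    rewrite expR_ge0.
rewrite mulrDl mul1r lerD//; first exact: le_trans ee.
by rewrite (le_trans ex)// ler_wpM2l.
Qed.

(** Bounding moments by exponential moments avoids identifying the law of a
    linear combination of independent normal variables. *)
Lemma subgaussian_moment (q : R) : 0 < q -> exists2 C : R, 0 < C &
  forall d (T : measurableType d) (P : {measure set T -> \bar R}) (X : T -> R)
    (v : R), 0 < v -> measurable_fun setT X ->
  (forall a, \int[P]_w (expR (a * X w))%:E <= (expR (a ^+ 2 * v ^+ 2 / 2))%:E)%E ->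
  (\int[P]_w (`|X w| `^ q)%:E <= ((C * v) `^ q)%:E)%E.
Proof.
move=> q0; have [C C0 HC] := powR_le_cosh q0.
exists ((C * (2 * expR 2^-1)) `^ q^-1) => [|d T P X v v0 mX mgf].
  by apply: powR_gt0; rewrite !mulr_gt0 ?expR_gt0.
have mE a : measurable_fun setT (fun w => expR (a * X w)).
  by apply: measurableT_comp => //; exact: measurable_funM.
have vq : 0 <= v `^ q * C by rewrite mulr_ge0 ?powR_ge0 ?ltW.
apply: (@le_trans _ _ (\int[P]_w ((v `^ q * C)%:E *
    ((expR (v^-1 * X w))%:E + (expR (- v^-1 * X w))%:E)))%E).
  apply: ge0_le_integral => //.
  - exact/measurable_EFinP/measurable_comp_powR/measurableT_comp.
  - by apply: emeasurable_funM => //; apply: emeasurable_funD;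
      exact/measurable_EFinP.
  - move=> w _; rewrite -EFinD -EFinM lee_fin.
    have {1}-> : X w = v * (v^-1 * X w) by rewrite mulVKf ?gt_eqF.
    rewrite normrM powRM// (gtr0_norm v0) -mulrA ler_wpM2l ?powR_ge0//.
    by rewrite mulNr; exact: HC.
rewrite ge0_integralZl_EFin//; last first.
- by apply: emeasurable_funD; exact/measurable_EFinP.
- by move=> w _; rewrite -EFinD lee_fin addr_ge0.
rewrite ge0_integralD//; last 2 first.
- exact/measurable_EFinP.
- exact/measurable_EFinP.
have -> : ((C * (2 * expR 2^-1)) `^ q^-1 * v) `^ q =
    v `^ q * C * (expR 2^-1 + expR 2^-1).
  have c0 : 0 <= C * (2 * expR 2^-1) by rewrite !mulr_ge0 ?expR_ge0// ltW.
  rewrite powRM ?powR_ge0//; last exact: ltW.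
  by rewrite -powRrM mulVf ?gt_eqF// powRr1//; ring.
rewrite [leRHS]EFinM; apply: lee_pmul => //.
  by rewrite adde_ge0// integral_ge0.
rewrite EFinD; apply: leeD; apply: (le_trans (mgf _)); rewrite lee_fin ler_expR.
  by rewrite exprVn mulVf ?mul1r ?expf_neq0 ?gt_eqF.
by rewrite sqrrN exprVn mulVf ?mul1r ?expf_neq0 ?gt_eqF.
Qed.

Lemma wiener_increment_mgf (P : probability (wiener R) R) (n : nat)
    (t a : nat -> R) : wiener_measure P ->
  0 <= t 0%N -> t n <= 1 -> (forall i, (i < n)%N -> t i < t i.+1) ->
  (\int[P]_w (expR (\sum_(0 <= i < n) a i *
      (wiener_val w (t i.+1) - wiener_val w (t i))))%:E =
   (expR (\sum_(0 <= i < n) a i ^+ 2 * (t i.+1 - t i) / 2))%:E)%E.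
Proof.
move=> hP t0 tn tlt.
pose s i := if (i < n)%N then Num.sqrt (t i.+1 - t i) else 1.
have s0 i : s i != 0.
  rewrite /s; case: ifP => [ltin|_]; last exact: oner_neq0.
  by rewrite gt_eqF// sqrtr_gt0 subr_gt0 tlt.
pose D i (w : wiener R) := w (t i.+1) - w (t i).
have mD i : measurable_fun setT (D i).
  by apply: measurable_funB; apply: measurable_wiener_continuous;
    exact: continuous_wiener_val.
pose N i : probability (measurableTypeR R) R := normal_prob 0 (s i).
have indep (A : nat -> set R) : (forall i, measurable (A i)) ->
    P [set w | forall i, (i < n)%N -> A i (D i w)] =
    (\prod_(0 <= i < n) N i (A i))%E.
  move=> mA; apply: (etrans (hP n t A t0 tn tlt mA)).
  by rewrite !big_mkord; apply: eq_bigr => i _; rewrite /N /s ltn_ord.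
have := indep_expectation mD indep (f := fun i x => expR (a i * x))
  (m := fun i => expR (a i ^+ 2 * s i ^+ 2 / 2)).
have mE i : measurable_fun setT (fun x : R => expR (a i * x)).
  by apply: measurableT_comp => //; exact: measurable_funM.
move=> /(_ mE (fun i x => expR_ge0 _) (fun i => normal_mgf (a i) (s0 i))).
move=> E; transitivity ((\prod_(i < n) expR (a i ^+ 2 * s i ^+ 2 / 2))%:E).
  by rewrite -E; apply: eq_integral => w _; rewrite big_mkord expR_sum.
congr EFin; rewrite big_mkord expR_sum; apply: eq_bigr => i _.
by rewrite /s ltn_ord sqr_sqrtr// subr_ge0 ltW// tlt.
Qed.

End gaussian_moments.

(** * Two facts of calculus *)

Section calculus.
Context {R : realType}.
Local Notation mu := (@lebesgue_measure R).

(** The kernel is monotone only to the right of 0, where it may be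
    unbounded. *)
Lemma nonincreasing_in_measurable (D : set R) (f : R -> R) : is_interval D ->
  (forall s t, D s -> D t -> s <= t -> f t <= f s) -> measurable_fun D f.
Proof.
move=> iD fni; apply: (measurability (@RGenCInfty.G R)) => [|/= _ [_] [r] -> <-].
  exact: RGenCInfty.measurableE.
apply: is_interval_measurable => s t /= [Ds].
rewrite !in_itv/= !andbT => fs [Dt ft] u /andP[su ut].
have Du : D u by apply: (iD _ _ Ds Dt); rewrite su.
by split=> //; rewrite /= in_itv/= andbT (le_trans ft)// fni.
Qed.

Lemma ge0_integral_shift (f : R -> R) (a b h : R) :
  measurable_fun setT f -> (forall x, 0 <= f x) ->
  (\int[mu]_(x in `](a + h)%R, (b + h)%R[) (f x)%:E =
   \int[mu]_(x in `]a, b[) (f (x + h))%:E)%E.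
Proof.
move=> mf f0.
pose S (x : measurableTypeR R) : measurableTypeR R := x + h.
have mS : measurable_fun setT S.
  exact: measurable_funD.
have shiftE (A : set (measurableTypeR R)) : measurable A ->
    pushforward mu S A = mu A.
  move=> mA; apply/esym/lebesgue_measure_unique => //= _ [[u v]] _ <-.
  rewrite /pushforward (_ : _ @^-1` _ = `]u - h, v - h]%classic).
    rewrite !lebesgue_measure_itv/= !lte_fin ltrD2r; case: ifP => // _.
    by congr (_%:E); ring.
  by apply/seteqP; split=> x /=; rewrite !in_itv/= ltrBlDr lerBrDr.
transitivity (\int[pushforward mu S]_(x in `](a + h)%R, (b + h)%R[) (f x)%:E)%E.
  by apply: eq_measure_integral => A mA _; exact/esym/shiftE.
rewrite ge0_integral_pushforward//=; last 2 first.
  by apply/measurable_EFinP; exact: measurable_funTS.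
  by move=> x _; rewrite lee_fin.
rewrite (_ : _ @^-1` _ = `]a, b[%classic)//.
by apply/seteqP; split=> x /=; rewrite !in_itv/= !ltrD2r.
Qed.

Lemma is_derive_powR_primitive (gamma v : R) : 0 < gamma -> 0 < v ->
  is_derive v 1 (fun u => gamma^-1 * u `^ gamma) (v `^ (gamma - 1)).
Proof.
move=> g0 v0; rewrite -[X in is_derive _ _ _ X](mulKf (lt0r_neq0 g0)).
have D := is_derive1_powR gamma v0.
exact: (@is_deriveZ _ _ _ (fun u : R => u `^ gamma) gamma^-1 v 1 _ D).
Qed.

Lemma continuous_powR_pos (q v : R) : 0 < v -> 
  {for v, continuous (fun u => u `^ q)}.
Proof.
move=> v0; apply: differentiable_continuous; apply/derivable1_diffP.
by apply: derivable_powR; rewrite in_itv/= andbT.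
Qed.

Lemma integral_powR_itv (gamma e x : R) : 0 < gamma -> 0 < e -> e < x ->
  (\int[mu]_(v in `[e, x]) (v `^ (gamma - 1))%:E =
   (gamma^-1 * x `^ gamma)%:E - (gamma^-1 * e `^ gamma)%:E)%E.
Proof.
move=> g0 e0 ex; have x0 : 0 < x by apply: lt_trans ex.
have cF v : 0 < v -> {for v, continuous (fun u => gamma^-1 * u `^ gamma)}.
  move=> v0; apply: differentiable_continuous; apply/derivable1_diffP.
  by have [] := is_derive_powR_primitive g0 v0.
apply: (continuous_FTC2 (F := fun u => gamma^-1 * u `^ gamma)) => //.
- apply: continuous_in_subspaceT => v /set_mem/=.
  rewrite in_itv/= => /andP[ev _]; apply: continuous_powR_pos.
  exact: lt_le_trans ev.
- split.
  + move=> v; rewrite in_itv/= => /andP[ev _].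
    by have [] := is_derive_powR_primitive g0 (lt_trans e0 ev).
  + by apply: cvg_at_right_filter; exact: cF.
  + by apply: cvg_at_left_filter; exact: cF.
- move=> v; rewrite in_itv/= => /andP[ev _]; rewrite derive1E.
  by have [] := is_derive_powR_primitive g0 (lt_trans e0 ev).
Qed.

(** The integrand may be unbounded at 0, so the fundamental theorem of calculus
    is applied on $[x / (n + 2), x]$ before letting $n$ go to infinity. *)
Lemma integral_powR_le (gamma x : R) : 0 < gamma -> 0 < x ->
  (\int[mu]_(v in `]0%R, x[) (v `^ (gamma - 1))%:E <= (x `^ gamma / gamma)%:E)%E.
Proof.
move=> g0 x0.
have mp (D : set R) : measurable_fun D (fun v : R => (v `^ (gamma - 1))%:E).
  by apply/measurable_EFinP/measurable_funTS; exact: measurable_powR.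
have p0 (v : R) : (0 <= (v `^ (gamma - 1))%:E)%E by rewrite lee_fin powR_ge0.
pose F (n : nat) : set R := `[x / n.+2%:R, x]%classic.
have eps0 n : 0 < x / n.+2%:R by rewrite divr_gt0.
have -> : (\int[mu]_(v in `]0%R, x[) (v `^ (gamma - 1))%:E =
    \int[mu]_(v in \bigcup_n F n) (v `^ (gamma - 1))%:E)%E.
  rewrite (_ : \bigcup_n F n = `]0, x]%classic).
    by rewrite integral_itv_bndo_bndc.
  apply/seteqP; split => v.
    move=> [n _]; rewrite /F /= !in_itv/= => /andP[ev ->]; rewrite andbT.
    exact: lt_le_trans ev.
  rewrite /= in_itv/= => /andP[v0 vx].
  exists (Num.truncn (x / v)) => //; rewrite /F /= in_itv/= vx andbT.
  rewrite ler_pdivrMr// mulrC -ler_pdivrMr//.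
  by rewrite (le_trans (ltW (truncnS_gt _)))// ler_nat.
have ndF : nondecreasing_seq F.
  apply/nondecreasing_seqP => n; rewrite subsetEset => v.
  rewrite /F /= !in_itv/= => /andP[+ ->]; rewrite andbT; apply: le_trans.
  by rewrite ler_pM2l// lef_pV2 ?posrE// ler_nat.
have Icvg := @ge0_nondecreasing_set_cvg_integral _ (measurableTypeR R) R F
  (fun v => (v `^ (gamma - 1))%:E) lebesgue_measure ndF
  (fun n => measurable_itv _) (fun n => mp _) (fun n v _ => p0 v).
rewrite -(cvg_lim (@ereal_hausdorff R) Icvg).
apply: lime_le.
  by apply/cvg_ex; eexists; exact: Icvg.
apply: nearW => n; rewrite /F integral_powR_itv//.
  rewrite -EFinB lee_fin mulrC lerBlDr lerDl.
  by rewrite mulr_ge0 ?invr_ge0 ?powR_ge0 ?ltW.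
by rewrite ltr_pdivrMr// ltr_pMr// ltr1n.
Qed.

End calculus.

(** * The Volterra kernel *)

Section volterra_integral.
Context {R : realType}.
Local Notation mu := (@lebesgue_measure R).
Variables (alpha t : R).
Hypothesis alpha_ge0 : 0 <= alpha.

Definition volterra_integrand s u : R := (u - s) `^ (alpha - 1) * u `^ alpha.

Definition volterra_integral s : \bar R :=
  (\int[mu]_(u in `]s, t[) (volterra_integrand s u)%:E)%E.

Lemma volterra_integrand_ge0 s u : 0 <= volterra_integrand s u.
Proof. by rewrite mulr_ge0 ?powR_ge0. Qed.

Lemma measurable_volterra_integrand s (D : set R) :
  measurable_fun D (volterra_integrand s).
Proof.
apply: measurable_funTS; apply: measurable_funM; last exact: measurable_powR.
by apply: measurable_comp_powR; exact: measurable_funB.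
Qed.

Lemma volterra_integral_ge0 s : (0 <= volterra_integral s)%E.
Proof. by apply: integral_ge0 => u _; rewrite lee_fin volterra_integrand_ge0. Qed.

(** Since $u \le t \le 1$, the integral is at most
    $\int_0^1 v^{\alpha - 1} dv$. *)
Lemma volterra_integral_le s : 0 < alpha -> t <= 1 -> 0 < s -> s < t ->
  (volterra_integral s <= (alpha^-1)%:E)%E.
Proof.
move=> a0 t_le1 s0 st.
have mf : measurable_fun setT (fun u : R => (u - s) `^ (alpha - 1)).
  by apply: measurable_comp_powR; exact: measurable_funB.
apply: (@le_trans _ _ (\int[mu]_(u in `]s, t[) ((u - s) `^ (alpha - 1))%:E)%E).
  apply: ge0_le_integral => //.
  - by move=> u _; rewrite lee_fin volterra_integrand_ge0.
  - by apply/measurable_EFinP; exact: measurable_volterra_integrand.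
  - by apply/measurable_EFinP; exact: measurable_funTS.
  - move=> u /=; rewrite in_itv/= => /andP[su ut]; rewrite lee_fin.
    rewrite ler_piMr ?powR_ge0//; apply: (@le_trans _ _ (1 `^ alpha)).
      apply: ge0_ler_powR; rewrite ?nnegrE//.
        by rewrite (le_trans _ (ltW su))// ltW.
      by rewrite (le_trans (ltW ut)).
    by rewrite powR1.
have := @ge0_integral_shift R _ 0 (t - s) s mf (fun u => powR_ge0 _ _).
rewrite add0r subrK => ->.
under eq_integral do rewrite addrK.
rewrite (le_trans (integral_powR_le a0 _)) ?subr_gt0// lee_fin.
rewrite ler_piMl ?invr_ge0//; apply: (@le_trans _ _ (1 `^ alpha)).
  apply: ge0_ler_powR; rewrite ?nnegrE ?subr_ge0//; first exact: ltW.
  by rewrite lerBlDr (le_trans t_le1)// lerDl ltW.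
by rewrite powR1.
Qed.

Lemma volterra_integrand_shift s s' v : 0 < s -> s <= s' -> s < v ->
  s' `^ (- alpha) * volterra_integrand s' (v + (s' - s)) <=
  s `^ (- alpha) * volterra_integrand s v.
Proof.
move=> s0 ss' sv; rewrite /volterra_integrand.
have -> : v + (s' - s) - s' = v - s by ring.
set e := s' - s; have e0 : 0 <= e by rewrite subr_ge0.
have s'E : s' = s + e by rewrite /e addrC subrK.
rewrite mulrCA [leRHS]mulrCA; apply: ler_wpM2l; first exact: powR_ge0.
have v0 : 0 < v by apply: lt_trans sv.
have s'0 : 0 < s' by apply: lt_le_trans ss'.
have vE : 0 < v + e by rewrite ltr_wpDr.
rewrite !powRN ![_^-1 * _]mulrC ler_pdivrMr; last exact: powR_gt0.
rewrite mulrAC ler_pdivlMr; last exact: powR_gt0.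
have [v0' s0' s'0' vE'] := And4 (ltW v0) (ltW s0) (ltW s'0) (ltW vE).
rewrite -(powRM _ vE' s0') -(powRM _ v0' s'0').
apply: ge0_ler_powR; rewrite ?nnegrE ?mulr_ge0//.
rewrite s'E; nra.
Qed.

(** After the change of variables $u = s + v$ the left-hand side reads
    $\int_0^{t - s} v^{\alpha - 1} (1 + v/s)^\alpha dv$, which decreases in
    $s$; here the two integrals are compared after a translation. *)
Lemma volterra_integral_nonincreasing s s' : 0 < s -> s <= s' ->
  ((s' `^ (- alpha))%:E * volterra_integral s' <=
   (s `^ (- alpha))%:E * volterra_integral s)%E.
Proof.
move=> s0 ss'; rewrite /volterra_integral.
set e := s' - s; have e0 : 0 <= e by rewrite subr_ge0.
pose J := `]s, (t - e)%R[%classic : set R.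
have mJ : measurable J by exact: measurable_itv.
have shift : (\int[mu]_(u in `]s', t[) (volterra_integrand s' u)%:E =
    \int[mu]_(v in J) (volterra_integrand s' (v + e))%:E)%E.
  rewrite -(ge0_integral_shift s (t - e) e
    (@measurable_volterra_integrand s' setT) (volterra_integrand_ge0 s')).
  by rewrite subrK /e addrC subrK.
have mI (D : set R) :
    measurable_fun D (fun v : R => (volterra_integrand s' (v + e))%:E).
  apply/measurable_EFinP/measurable_funTS.
  apply: (@measurableT_comp _ _ _ _ _ _ (volterra_integrand s') _
    (fun v : R => v + e)); first exact: measurable_volterra_integrand.
  exact: measurable_funD.
have mI0 (D : set R) : measurable_fun D (fun v : R => (volterra_integrand s v)%:E).
  by apply/measurable_EFinP; exact: measurable_volterra_integrand.
have I0 (r v : R) : (0 <= (volterra_integrand r v)%:E)%E.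
  by rewrite lee_fin volterra_integrand_ge0.
have c0 (r : R) : (0 <= (r `^ (- alpha))%:E)%E by rewrite lee_fin powR_ge0.
have mcI (r : R) (f : R -> \bar R) (D : set R) : measurable_fun D f ->
    measurable_fun D (fun v => (r `^ (- alpha))%:E * f v)%E.
  by move=> mf; apply: emeasurable_funM => //; exact: measurable_cst.
have pull (r : R) (f : R -> \bar R) (D : set R) :
    measurable D -> measurable_fun D f -> (forall v, (0 <= f v)%E) ->
    ((r `^ (- alpha))%:E * \int[mu]_(v in D) f v =
     \int[mu]_(v in D) ((r `^ (- alpha))%:E * f v))%E.
  by move=> mD mf f0; rewrite ge0_integralZl_EFin// powR_ge0.
rewrite shift pull; [|exact: mJ|exact: mI|by move=> v; exact: I0].
rewrite pull; [|exact: measurable_itv|exact: mI0|by move=> v; exact: I0].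
apply: (@le_trans _ _ (\int[mu]_(v in J)
    ((s `^ (- alpha))%:E * (volterra_integrand s v)%:E))%E).
  apply: ge0_le_integral; first exact: mJ.
  - by move=> v _; exact: mule_ge0.
  - exact: mcI.
  - exact: mcI.
  - move=> v; rewrite /J /= in_itv/= => /andP[sv _].
    by rewrite -!EFinM lee_fin volterra_integrand_shift.
apply: ge0_subset_integral; [exact: mJ|exact: measurable_itv| | |].
- exact: mcI.
- by move=> v _; exact: mule_ge0.
- move=> v; rewrite /J /= !in_itv/= => /andP[-> vt] /=.
  by apply: (lt_le_trans vt); rewrite lerBlDr lerDl.
Qed.

End volterra_integral.

Section volterra_kernel_bounds.
Context {R : realType}.
Variables (H c t : R).
Hypothesis H_ge : 2^-1 <= H.
Hypothesis c_gt0 : 0 < c.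
Hypothesis t_le1 : t <= 1.

Local Notation k := (volterra_kernel H c t).
Local Notation alpha := (H - 2^-1).

Lemma volterra_kernelE s : 2^-1 < H -> 0 < s -> s < t ->
  k s = c * (s `^ (- alpha) * fine (volterra_integral alpha t s)).
Proof.
move=> Hgt s0 st; rewrite /volterra_kernel s0 st /= gt_eqF//.
have HE : H - 3 / 2 = alpha - 1 by field.
by rewrite HE opprB mulrA.
Qed.

Lemma volterra_kernel_out s : ~~ (0 < s < t) -> k s = 0.
Proof. by rewrite /volterra_kernel => /negbTE ->. Qed.

Lemma volterra_kernel_half s : H = 2^-1 -> 0 < s -> s < t -> k s = 1.
Proof. by move=> HE s0 st; rewrite /volterra_kernel s0 st HE eqxx. Qed.

Lemma volterra_kernel_ge0 s : 0 <= k s.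
Proof.
rewrite /volterra_kernel; case: ifP => // _; case: ifP => // _.
rewrite !mulr_ge0 ?powR_ge0//; first exact: ltW.
by apply: Rintegral_ge0 => u _; rewrite mulr_ge0 ?powR_ge0.
Qed.

Lemma volterra_kernel_le : exists2 C : R, 0 < C &
  forall s, 0 < s -> k s <= C * s `^ (- alpha).
Proof.
have [Hgt|Hle] := ltP 2^-1 H; last first.
  have HE : H = 2^-1 by apply/eqP; rewrite eq_le Hle.
  exists 1 => // s s0; rewrite /volterra_kernel HE eqxx subrr oppr0 powRr0 mulr1.
  by case: ifP.
have a0 : 0 < alpha by rewrite subr_gt0.
exists (c * alpha^-1) => [|s s0]; first by rewrite mulr_gt0 ?invr_gt0.
have [st|ts] := ltP s t; last first.
  rewrite volterra_kernel_out ?mulr_ge0 ?powR_ge0 ?invr_ge0 ?ltW//.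
  by rewrite s0 /= -leNgt.
rewrite (volterra_kernelE Hgt s0 st) -mulrA.
apply: ler_wpM2l; first exact: ltW.
rewrite mulrC; apply: ler_wpM2r; first exact: powR_ge0.
have inn := volterra_integral_le (ltW a0) a0 t_le1 s0 st.
rewrite -lee_fin fineK// ge0_fin_numE ?volterra_integral_ge0//.
by rewrite (le_lt_trans inn)// ltry.
Qed.

Lemma volterra_kernel_nonincreasing s s' : 0 < s -> s <= s' -> k s' <= k s.
Proof.
move=> s0 ss'; have s'0 : 0 < s' by apply: lt_le_trans ss'.
have [s't|ts'] := ltP s' t; last first.
  by rewrite volterra_kernel_out ?volterra_kernel_ge0// s'0 /= -leNgt.
have st : s < t by apply: le_lt_trans s't.
have [Hgt|Hle] := ltP 2^-1 H; last first.
  have HE : H = 2^-1 by apply/eqP; rewrite eq_le Hle.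
  by rewrite !volterra_kernel_half.
have a0 : 0 < alpha by rewrite subr_gt0.
rewrite (volterra_kernelE Hgt s0 st) (volterra_kernelE Hgt s'0 s't).
apply: ler_wpM2l; first exact: ltW.
have fin u : 0 < u -> u < t -> volterra_integral alpha t u \is a fin_num.
  move=> u0 ut; rewrite ge0_fin_numE ?volterra_integral_ge0//.
  by rewrite (le_lt_trans (volterra_integral_le (ltW a0) a0 t_le1 u0 ut))// ltry.
have := volterra_integral_nonincreasing t (ltW a0) s0 ss'.
by rewrite -(fineK (fin _ s0 st)) -(fineK (fin _ s'0 s't)) -!EFinM lee_fin.
Qed.

End volterra_kernel_bounds.

(** * Averages of a nonincreasing function *)

Section monotone_averages.
Context {R : realType}.
Local Notation mu := (@lebesgue_measure R).
Variables (k : R -> R) (alpha C : R).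
Hypothesis alpha_lt1 : alpha < 1.
Hypothesis k_ge0 : forall s, 0 <= k s.
Hypothesis k_nonincreasing : forall s s', 0 < s -> s <= s' -> k s' <= k s.
Hypothesis k_le : forall s, 0 < s -> k s <= C * s `^ (- alpha).

Let gamma_gt0 : 0 < 1 - alpha. Proof. by rewrite subr_gt0. Qed.

Let C_ge0 : 0 <= C.
Proof. by have := k_le ltr01; rewrite powR1 mulr1; apply: le_trans. Qed.

Let measurable_k_oc (x : R) : measurable_fun `]0, x] k.
Proof.
apply: nonincreasing_in_measurable => [|s s' /=]; first exact: interval_is_interval.
rewrite !in_itv/= => /andP[s0 _] _; exact: k_nonincreasing.
Qed.

Let mk (x : R) : measurable_fun `[0, x] (fun s => (k s)%:E).
Proof.
by apply/emeasurable_fun_itv_obnd_cbndP/measurable_EFinP; exact: measurable_k_oc.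
Qed.

Lemma integral_k_le (x : R) : 0 < x ->
  (\int[mu]_(s in `[0%R, x]) (k s)%:E <=
   (C * (x `^ (1 - alpha) / (1 - alpha)))%:E)%E.
Proof.
move=> x0.
have mp : measurable_fun setT (fun s : R => (s `^ (1 - alpha - 1))%:E).
  by apply/measurable_EFinP; exact: measurable_powR.
rewrite -integral_itv_obnd_cbnd; last first.
  by apply/measurable_EFinP; exact: measurable_k_oc.
apply: (@le_trans _ _ (\int[mu]_(s in `]0%R, x])
    (C%:E * (s `^ (1 - alpha - 1))%:E))%E).
  apply: ge0_le_integral => //.
  - by move=> s _; rewrite lee_fin.
  - by apply/measurable_EFinP; exact: measurable_k_oc.
  - by apply: emeasurable_funM => //; exact: measurable_funTS.
  - move=> s /=; rewrite in_itv/= => /andP[s0 _].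
    by rewrite -EFinM lee_fin (_ : 1 - alpha - 1 = - alpha) ?k_le//; ring.
rewrite ge0_integralZl_EFin//; last 2 first.
- by move=> s _; rewrite lee_fin powR_ge0.
- exact: measurable_funTS.
rewrite -integral_itv_bndo_bndc; last exact: measurable_funTS.
rewrite EFinM; apply: lee_pmul => //.
- by apply: integral_ge0 => s _; rewrite lee_fin powR_ge0.
- exact: integral_powR_le.
Qed.

Lemma integrable_k (a b : R) : 0 <= a -> mu.-integrable `[a, b] (EFin \o k).
Proof.
move=> a0; have b0 : 0 < Num.max b 1 by rewrite lt_max ltr01 orbT.
have : mu.-integrable `[0, Num.max b 1] (EFin \o k).
  apply/integrableP; split; first exact: mk.
  under eq_integral do rewrite /comp abse_EFin ger0_norm//.
  by rewrite (le_lt_trans (integral_k_le b0))// ltry.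
apply: integrableS => //; apply: subset_itv; rewrite bnd_simp//.
by rewrite le_max lexx.
Qed.

Definition kint (a b : R) : R := \int[mu]_(u in `[a, b]) k u.

Lemma kint_ge0 a b : 0 <= kint a b.
Proof. by apply: Rintegral_ge0. Qed.

Lemma kint_split a x b : 0 <= a -> a <= x -> x <= b ->
  kint a b = kint a x + kint x b.
Proof.
move=> a0 ax xb; rewrite /kint.
have ik := integrable_k b a0.
have := @Rintegral_itvB _ k (BLeft a) (BRight b) x ik.
rewrite !bnd_simp => /(_ ax xb); rewrite Rintegral_itv_obnd_cbnd => [<-|].
  by rewrite addrC subrK.
have x0 : 0 <= x by exact: le_trans ax.
by apply: integrableS (integrable_k b x0) => //; exact: subset_itv_oc_cc.
Qed.

Let integrable_cst_itv (a b y : R) (i j : bool) :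
  mu.-integrable [set` Interval (BSide i a) (BSide j b)] (EFin \o cst y).
Proof.
apply: (@integrableS _ _ _ mu `[a, b]) => //.
  by case: i; case: j; apply: subset_itv; rewrite bnd_simp.
apply: continuous_compact_integrable; first exact: segment_compact.
exact/continuous_subspaceT/cst_continuous.
Qed.

Lemma kint_le a b : 0 < a -> a <= b -> kint a b <= (b - a) * k a.
Proof.
move=> a0 ab; rewrite /kint.
apply: (@le_trans _ _ (\int[mu]_(u in `[a, b]) (cst (k a) u))).
  apply: le_Rintegral => //; first exact/integrable_k/ltW.
  by move=> u /=; rewrite in_itv/= => /andP[au _]; exact: k_nonincreasing.
rewrite Rintegral_cst//= lebesgue_measure_itv/= lte_fin mulrC.
by move: ab; rewrite le_eqVlt => /predU1P[->|->]; rewrite ?ltxx ?subrr.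
Qed.

Lemma kint_ge a b : 0 <= a -> a <= b -> (b - a) * k b <= kint a b.
Proof.
move=> a0 ab; have ik := integrable_k b a0.
have iko : mu.-integrable `]a, b] (EFin \o k).
  by apply: integrableS ik => //; exact: subset_itv_oc_cc.
rewrite /kint -Rintegral_itv_obnd_cbnd//.
apply: (@le_trans _ _ (\int[mu]_(u in `]a, b]) (cst (k b) u))).
  rewrite Rintegral_cst//= lebesgue_measure_itv/= lte_fin mulrC.
  by move: ab; rewrite le_eqVlt => /predU1P[->|->]; rewrite ?ltxx ?subrr.
apply: le_Rintegral => //.
move=> u /=; rewrite in_itv/= => /andP[au ub]; apply: k_nonincreasing => //.
exact: le_lt_trans au.
Qed.

Lemma kint0_le x : 0 < x -> kint 0 x <= C * (x `^ (1 - alpha) / (1 - alpha)).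
Proof.
move=> x0; rewrite -lee_fin fineK ?integral_k_le//.
exact/integrable_fin_num/integrable_k.
Qed.

End monotone_averages.

(** * Dyadic step functions *)

Section dyadic_steps.
Context {R : realType}.
Local Notation mu := (@lebesgue_measure R).
Variable t : R.
Hypothesis t_gt0 : 0 < t.
Hypothesis t_le1 : t <= 1.

Definition dyadic_node (m i : nat) : R := i%:R / 2 ^+ m * t.

Let pow2_gt0 m : 0 < 2 ^+ m :> R. Proof. by rewrite exprn_gt0. Qed.

Lemma dyadic_node0 m : dyadic_node m 0 = 0.
Proof. by rewrite /dyadic_node !mul0r. Qed.

Lemma dyadic_nodeS m i : dyadic_node m i.+1 - dyadic_node m i = t / 2 ^+ m.
Proof. by rewrite /dyadic_node -mulrBl -mulrBl -natr1 addrAC subrr add0r mul1r mulrC. Qed.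

Lemma dyadic_node_double m i : dyadic_node m.+1 i.*2 = dyadic_node m i.
Proof.
rewrite /dyadic_node -muln2 natrM exprS.
by field; rewrite gt_eqF.
Qed.

Lemma dyadic_node_homo m : {homo dyadic_node m : i j / (i <= j)%N >-> i <= j}.
Proof.
move=> i j ij; apply: ler_wpM2r; first exact: ltW.
by apply: ler_wpM2r; rewrite ?ler_nat// invr_ge0 ltW.
Qed.

Lemma dyadic_node_ge0 m i : 0 <= dyadic_node m i.
Proof. by rewrite -(dyadic_node0 m) dyadic_node_homo. Qed.

Lemma dyadic_node_last m : dyadic_node m (2 ^ m) = t.
Proof. by rewrite /dyadic_node natrX divff ?mul1r// gt_eqF. Qed.

Lemma dyadic_node_le m (i : 'I_(2 ^ m)) : 0 <= dyadic_node m i /\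
  dyadic_node m i <= dyadic_node m i.+1 /\ dyadic_node m i.+1 <= 1.
Proof.
split; first exact: dyadic_node_ge0; split; first exact: dyadic_node_homo.
by rewrite (le_trans _ t_le1)// -[leRHS](dyadic_node_last m) dyadic_node_homo.
Qed.

Definition dyadic_step (m : nat) (a : nat -> R) : @step R :=
  Step (fun i : 'I_(2 ^ m) => a i) (@dyadic_node_le m).

Definition dyadic_increment m i (w : wiener R) : R :=
  w (dyadic_node m i.+1) - w (dyadic_node m i).

Lemma dyadic_step_integral m a w : step_integral (dyadic_step m a) w =
  \sum_(0 <= i < 2 ^ m) a i * dyadic_increment m i w.
Proof. by rewrite big_mkord. Qed.

Lemma dyadic_step_fun_sqr m a s : (step_fun (dyadic_step m a) s) ^+ 2 =
  \sum_(i < 2 ^ m)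
    a i ^+ 2 * \1_(`]dyadic_node m i, dyadic_node m i.+1]) s.
Proof.
rewrite /step_fun /= expr2 big_distrl/=; apply: eq_bigr => i _.
rewrite big_distrr/= (bigD1 i)//= big1 ?addr0 => [|j ji]; last first.
  rewrite !indicE; have [/set_mem/= si|_] := boolP (s \in _); last first.
    by rewrite mulr0 mul0r.
  have [/set_mem/= sj|_] := boolP (s \in _); last by rewrite !mulr0.
  move: si sj; rewrite !in_itv/= => /andP[i1 i2] /andP[j1 j2]; exfalso.
  have [ij|ij] := ltnP i j.
    by have := lt_le_trans j1 (le_trans i2 (dyadic_node_homo m ij)); rewrite ltxx.
  have {}ij : (j < i)%N by rewrite ltn_neqAle ij andbT.
  by have := lt_le_trans i1 (le_trans j2 (dyadic_node_homo m ij)); rewrite ltxx.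
rewrite mulrACA -expr2; congr (_ * _); rewrite indicE.
by case: (s \in _); rewrite ?mulr1 ?mulr0.
Qed.

Lemma dyadic_step_energy m a :
  (\int[mu]_(s in `[0%R, 1%R]) ((step_fun (dyadic_step m a) s) ^+ 2)%:E <=
   (\sum_(0 <= i < 2 ^ m) a i ^+ 2 * (t / 2 ^+ m))%:E)%E.
Proof.
under eq_integral do rewrite dyadic_step_fun_sqr -sumEFin.
have mI i : measurable_fun (`[0, 1]%classic : set R)
    (\1_(`]dyadic_node m i, dyadic_node m i.+1]) : R -> R) by [].
rewrite ge0_integral_sum//; last 2 first.
- by move=> i; apply/measurable_EFinP; exact: measurable_funM.
- by move=> i s _; rewrite lee_fin mulr_ge0 ?sqr_ge0.
rewrite big_mkord -sumEFin; apply: lee_sum => i _.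
under eq_integral do rewrite EFinM.
rewrite ge0_integralZl_EFin ?sqr_ge0//; last first.
  exact/measurable_EFinP.
rewrite [leRHS]EFinM; apply: lee_pmul => //; rewrite ?lee_fin ?sqr_ge0//.
  by apply: integral_ge0 => s _; rewrite lee_fin.
rewrite integral_indic//.
apply: (@le_trans _ _ (mu `]dyadic_node m i, dyadic_node m i.+1]%classic)).
  by apply: le_measure; rewrite ?inE//; exact: measurableI.
rewrite lebesgue_measure_itv/= lte_fin; case: ifP => _; last first.
  by rewrite lee_fin divr_ge0// ltW.
by rewrite -EFinB dyadic_nodeS.
Qed.

Lemma dyadic_step_mgf (P : probability (wiener R) R) m a y :
  wiener_measure P ->
  (\int[P]_w (expR (y * step_integral (dyadic_step m a) w))%:E =
   (expR (y ^+ 2 * (\sum_(0 <= i < 2 ^ m) a i ^+ 2 * (t / 2 ^+ m)) / 2))%:E)%E.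
Proof.
move=> hP; have := @wiener_increment_mgf R P (2 ^ m) (dyadic_node m)
  (fun i => y * a i) hP.
rewrite dyadic_node0 lexx dyadic_node_last => /(_ isT t_le1 _)H.
transitivity (\int[P]_w (expR (\sum_(0 <= i < 2 ^ m) y * a i *
    (wiener_val w (dyadic_node m i.+1) - wiener_val w (dyadic_node m i))))%:E)%E.
  apply: eq_integral => w _; rewrite dyadic_step_integral mulr_sumr.
  by congr (expR _)%:E; apply: eq_bigr => i _; rewrite mulrA.
rewrite H => [|i _]; last by rewrite -subr_gt0 dyadic_nodeS divr_gt0.
congr (expR _)%:E; rewrite mulr_sumr mulr_suml; apply: eq_bigr => i _.
by rewrite dyadic_nodeS exprMn !mulrA.
Qed.

Lemma big_nat_double (F : nat -> R) n : \sum_(0 <= j < n.*2) F j =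
  \sum_(0 <= i < n) (F i.*2 + F i.*2.+1).
Proof.
elim: n => [|n IH]; first by rewrite !big_geq.
by rewrite doubleS 2?big_nat_recr//= IH -addrA [in RHS]big_nat_recr.
Qed.

(** Half of the jump between the two halves of a coarse interval, with opposite
    signs on the two halves: the component of [b] in the Haar system. *)
Definition haar_coef (b : nat -> R) (j : nat) : R :=
  (-1) ^+ odd j * ((b j./2.*2 - b j./2.*2.+1) / 2).

Let haar_even b i : haar_coef b i.*2 = (b i.*2 - b i.*2.+1) / 2.
Proof. by rewrite /haar_coef odd_double doubleK mul1r. Qed.

Let haar_odd b i : haar_coef b i.*2.+1 = - ((b i.*2 - b i.*2.+1) / 2).
Proof. by rewrite /haar_coef /= odd_double uphalf_double mulN1r. Qed.

(** The coarse coefficients are the averages of the fine ones, so the difference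
    has opposite coefficients on the two halves of each coarse interval. *)
Lemma haar_step_integral (a b : nat -> R) m w :
  (forall i, a i = (b i.*2 + b i.*2.+1) / 2) ->
  step_integral (dyadic_step m.+1 b) w - step_integral (dyadic_step m a) w =
  step_integral (dyadic_step m.+1 (haar_coef b)) w.
Proof.
move=> ab; rewrite !dyadic_step_integral expnS mul2n !big_nat_double -sumrB.
apply: eq_bigr => i _; rewrite haar_even haar_odd ab.
have -> : dyadic_increment m i w =
    dyadic_increment m.+1 i.*2 w + dyadic_increment m.+1 i.*2.+1 w.
  rewrite /dyadic_increment -doubleS !dyadic_node_double.
  by ring.
by field.
Qed.

(** A squared jump is at most [b 0] times the jump, and the jumps of a
    nonincreasing nonnegative sequence add up to at most [b 0]. *)
Lemma haar_variance_le (b : nat -> R) n : (forall i, 0 <= b i) ->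
  (forall i, b i.+1 <= b i) ->
  \sum_(0 <= j < n.*2) haar_coef b j ^+ 2 <= b 0%N ^+ 2.
Proof.
move=> b0 bS; rewrite big_nat_double.
have homo i j : (i <= j)%N -> b j <= b i.
  by move=> /subnKC <-; elim: (j - i)%N => [|l IH]; rewrite ?addn0// addnS;
    exact: le_trans IH.
have jump i : 0 <= b i.*2 - b i.*2.+1 by rewrite subr_ge0.
have tot : \sum_(0 <= i < n) (b i.*2 - b i.*2.+1) <= b 0%N - b n.*2.
  elim: n => [|n IH]; first by rewrite big_geq// subrr.
  rewrite big_nat_recr//= doubleS; have := bS n.*2.+1; move: IH; lra.
apply: (@le_trans _ _ (\sum_(0 <= i < n) b 0%N * (b i.*2 - b i.*2.+1))).
  apply: ler_sum => i _; rewrite haar_even haar_odd sqrrN.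
  have := jump i; have := homo 0%N i.*2 (leq0n _); have := b0 i.*2.+1.
  set x := b i.*2; set y := b i.*2.+1 => *; nra.
rewrite -mulr_sumr expr2 ler_wpM2l// (le_trans tot)// lerBlDr lerDl//.
Qed.

End dyadic_steps.

(** * Geometric decay of the dyadic differences *)

Section dyadic_averages.
Context {R : realType}.
Local Notation mu := (@lebesgue_measure R).
Variables (t : R) (k : R -> R) (alpha C : R).
Hypothesis t_gt0 : 0 < t.
Hypothesis t_le1 : t <= 1.
Hypothesis alpha_ge0 : 0 <= alpha.
Hypothesis alpha_lt : alpha < 2^-1.
Hypothesis k_ge0 : forall s, 0 <= k s.
Hypothesis k_nonincreasing : forall s s', 0 < s -> s <= s' -> k s' <= k s.
Hypothesis k_le : forall s, 0 < s -> k s <= C * s `^ (- alpha).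

Let alpha_lt1 : alpha < 1. Proof. by move: alpha_lt; lra. Qed.

Let pow2_gt0 m : 0 < 2 ^+ m :> R. Proof. by rewrite exprn_gt0. Qed.

Let delta m : R := t / 2 ^+ m.

Let delta_gt0 m : 0 < delta m. Proof. by rewrite divr_gt0. Qed.

Definition dyadic_average (m i : nat) : R :=
  2 ^+ m / t * kint k (dyadic_node t m i) (dyadic_node t m i.+1).

Let averageE m i : dyadic_average m i =
  (delta m)^-1 * kint k (dyadic_node t m i) (dyadic_node t m i.+1).
Proof. by rewrite /dyadic_average /delta invf_div. Qed.

Lemma dyadic_average_ge0 m i : 0 <= dyadic_average m i.
Proof. by rewrite averageE mulr_ge0 ?kint_ge0// invr_ge0 ltW. Qed.

Lemma dyadic_average_nonincreasing m i :
  dyadic_average m i.+1 <= dyadic_average m i.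
Proof.
rewrite !averageE ler_wpM2l//; first by rewrite invr_ge0 ltW.
have node_gt0 : 0 < dyadic_node t m i.+1.
  by rewrite -(subrK (dyadic_node t m i) (dyadic_node t m i.+1)) dyadic_nodeS
    ltr_pwDl ?dyadic_node_ge0// delta_gt0.
apply: (@le_trans _ _ (delta m * k (dyadic_node t m i.+1))).
  rewrite /delta -(dyadic_nodeS t m i.+1).
  apply: (kint_le alpha_lt1 k_ge0 k_nonincreasing k_le) => //.
  exact: dyadic_node_homo.
rewrite /delta -(dyadic_nodeS t m i).
apply: (kint_ge alpha_lt1 k_ge0 k_nonincreasing k_le).
  exact: dyadic_node_ge0.
exact: dyadic_node_homo.
Qed.

Lemma dyadic_average_refine m i : dyadic_average m i =
  (dyadic_average m.+1 i.*2 + dyadic_average m.+1 i.*2.+1) / 2.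
Proof.
rewrite /dyadic_average -doubleS !dyadic_node_double.
rewrite (kint_split alpha_lt1 k_ge0 k_nonincreasing k_le
  (x := dyadic_node t m.+1 i.*2.+1)).
- by rewrite exprS; field; rewrite gt_eqF.
- exact: dyadic_node_ge0.
- by rewrite -(dyadic_node_double t m i) dyadic_node_homo.
- by rewrite -(dyadic_node_double t m i.+1) doubleS dyadic_node_homo.
Qed.

Lemma dyadic_average0_le m :
  dyadic_average m 0 <= C / (1 - alpha) * delta m `^ (- alpha).
Proof.
rewrite averageE dyadic_node0.
have -> : dyadic_node t m 1 = delta m.
  by rewrite -[LHS]subr0 -{1}(dyadic_node0 t m) dyadic_nodeS.
have := kint0_le alpha_lt1 k_ge0 k_nonincreasing k_le (delta_gt0 m).
move=> le; rewrite mulrC ler_pdivrMr//; apply: (le_trans le).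
rewrite (_ : 1 - alpha = - alpha + 1); last by rewrite addrC.
rewrite powRD; last first.
  by apply/implyP => _; rewrite gt_eqF.
by rewrite powRr1 ?(ltW (delta_gt0 m))// le_eqVlt; apply/orP; left; apply/eqP; ring.
Qed.

Let beta : R := 1 - 2 * alpha.
Let beta_gt0 : 0 < beta. Proof. by move: alpha_lt; rewrite /beta; lra. Qed.

(** The variance at mesh $\delta$ is at most $\delta$ times the square of the
    first average, which is of order $\delta^{- \alpha}$; and
    $1 - 2 \alpha > 0$. *)
Lemma haar_variance_decay n :
  \sum_(0 <= j < 2 ^ n.+1)
    haar_coef (dyadic_average n.+1) j ^+ 2 * (t / 2 ^+ n.+1) <=
  (C / (1 - alpha)) ^+ 2 * (2^-1 `^ beta) ^+ n.+1.
Proof.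
rewrite -mulr_suml -/(delta n.+1) expnS mul2n.
set m := n.+1; set A := C / (1 - alpha).
have d0 := delta_gt0 m; have d0' := ltW d0.
apply: (@le_trans _ _ (dyadic_average m 0 ^+ 2 * delta m)).
  rewrite ler_wpM2r// haar_variance_le// => i; first exact: dyadic_average_ge0.
  exact: dyadic_average_nonincreasing.
apply: (@le_trans _ _ ((A * delta m `^ (- alpha)) ^+ 2 * delta m)).
  rewrite ler_wpM2r// lerXn2r ?nnegrE ?dyadic_average_ge0//.
    exact: le_trans (dyadic_average_ge0 m 0) (dyadic_average0_le m).
  exact: dyadic_average0_le.
rewrite exprMn -mulrA ler_wpM2l ?sqr_ge0//.
have -> : (delta m `^ (- alpha)) ^+ 2 * delta m = delta m `^ beta.
  rewrite -[X in _ * X = _]powRr1// -powR_mulrn ?powR_ge0// -powRrM -powRD.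
    by congr (_ `^ _); rewrite /beta; ring.
  by apply/implyP => _; rewrite gt_eqF.
rewrite -powR_mulrn ?powR_ge0// powRAC powR_mulrn ?invr_ge0//.
apply: ge0_ler_powR; rewrite ?nnegrE ?exprn_ge0 ?invr_ge0//; first exact: ltW.
by rewrite /delta exprVn ler_piMl// invr_ge0 ltW.
Qed.

End dyadic_averages.

Section dyadic_fbm_steps.
Context {R : realType}.

(** Supplies the empty step function, which represents the process at time 0. *)
Lemma zero_step_subproof (i : 'I_0) : (0 : R) <= (0 : R) /\ (0 : R) <= (0 : R)
  /\ (0 : R) <= 1.
Proof. by case: i. Qed.

(** The data on which the probabilistic part relies: the approximations are
    partial sums of Wiener integrals [d i] whose variances decay
    geometrically. *)
Lemma dyadic_fbm_steps (P : probability (wiener R) R) (H c t : R) :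
  wiener_measure P -> H \in `[2^-1, 1[ -> 0 < c -> t \in `[0, 1] ->
  exists d : nat -> @step R, exists M : R, exists eta : R,
  [/\ 0 < M, 0 < eta < 1,
      forall n w, dyadic_fbm H c t n.+1 w =
        \sum_(0 <= i < n.+1) step_integral (d i) w,
      forall i, (\int[lebesgue_measure]_(s in `[0%R, 1%R])
        ((step_fun (d i) s) ^+ 2)%:E <= ((M * (eta ^+ 2) ^+ i) ^+ 2)%:E)%E &
      forall i y, (\int[P]_w (expR (y * step_integral (d i) w))%:E <=
        (expR (y ^+ 2 * (M * (eta ^+ 2) ^+ i) ^+ 2 / 2))%:E)%E].
Proof.
move=> hP; rewrite !in_itv/= => /andP[H2 H1] c0 /andP[t0 t1].
move: t0; rewrite le_eqVlt => /predU1P[<-|t0].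
  exists (fun=> Step (fun=> 0) zero_step_subproof), 1, 2^-1; split => //.
  - by rewrite invr_gt0 ltr0n invf_lt1// ltr1n.
  - move=> n w; rewrite /dyadic_fbm eqxx big1// => i _.
    by rewrite /step_integral /= big_ord0.
  - move=> i; rewrite /step_fun; under eq_integral do rewrite big_ord0 expr0n/=.
    by rewrite integral0 lee_fin sqr_ge0.
  - move=> i y; rewrite /step_integral.
    under eq_integral do rewrite big_ord0 mulr0 expR0.
    rewrite integral_cst//= probability_setT mule1 lee_fin -expR0 ler_expR.
    by rewrite divr_ge0// mulr_ge0 ?sqr_ge0.
set k := volterra_kernel H c t; pose alpha := H - 2^-1.
have alpha_ge0 : 0 <= alpha by rewrite subr_ge0.
have alpha_lt : alpha < 2^-1 by rewrite /alpha; move: H1; lra.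
have k0 s : 0 <= k s by exact: volterra_kernel_ge0.
have kni s s' : 0 < s -> s <= s' -> k s' <= k s.
  exact: volterra_kernel_nonincreasing.
have [C C0 kC] := volterra_kernel_le H2 c0 t1.
pose b := dyadic_average t k.
pose d i := if i is n.+1 then dyadic_step t0 t1 n.+2 (haar_coef (b n.+2))
            else dyadic_step t0 t1 1 (b 1%N).
pose beta := 1 - 2 * alpha.
have beta0 : 0 < beta by rewrite /beta; move: alpha_lt; lra.
(* variances decay like $\eta^4$ to the power $i$, standard deviations like
   $(\eta^2)^i$; this leaves room for thresholds of size $\eta^i$ *)
pose eta : R := 2^-1 `^ (beta / 4).
have eta0 : 0 < eta by rewrite powR_gt0// invr_gt0.
have half_lt1 (q : R) : 0 < q -> 2^-1 `^ q < 1 :> R.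
  move=> q0; rewrite [ltRHS](_ : 1 = 1 `^ q); last by rewrite powR1.
  by apply: gt0_ltr_powR; rewrite ?nnegrE ?invr_ge0// invf_lt1// ltr1n.
have eta1 : eta < 1 by apply: half_lt1; rewrite divr_gt0.
have eta4 : eta ^+ 4 = 2^-1 `^ beta.
  by rewrite -powR_mulrn ?powR_ge0// -powRrM; congr (_ `^ _); field.
pose v0 := \sum_(0 <= i < 2 ^ 1) b 1%N i ^+ 2 * (t / 2 ^+ 1).
have v00 : 0 <= v0.
  by apply: sumr_ge0 => i _; rewrite mulr_ge0 ?sqr_ge0// divr_ge0// ltW.
pose A := C / (1 - alpha).
have A0 : 0 < A by rewrite divr_gt0// subr_gt0; move: alpha_lt; lra.
(* [A] serves for the differences, [1 + v0] for the initial term *)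
pose M := A + (1 + v0).
have M0 : 0 < M by rewrite addr_gt0// ltr_pwDl.
pose v i := if i is n.+1 then
    \sum_(0 <= j < 2 ^ n.+2) haar_coef (b n.+2) j ^+ 2 * (t / 2 ^+ n.+2)
  else v0.
have vle i : v i <= (M * (eta ^+ 2) ^+ i) ^+ 2.
  case: i => [|n].
    rewrite expr0 mulr1 /v /M; have := v00; have := A0; nra.
  apply: (@le_trans _ _ (A ^+ 2 * (2^-1 `^ beta) ^+ n.+2)).
    exact: haar_variance_decay.
  have -> : (M * (eta ^+ 2) ^+ n.+1) ^+ 2 = M ^+ 2 * (2^-1 `^ beta) ^+ n.+1.
    by rewrite exprMn -eta4 -!exprM mulnAC.
  apply: ler_pM; rewrite ?sqr_ge0 ?exprn_ge0 ?powR_ge0//.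
    by rewrite lerXn2r ?nnegrE ?ltW// /M; move: v00; lra.
  by rewrite exprS ler_piMl ?exprn_ge0 ?powR_ge0// ltW ?half_lt1.
have fbmE m w : dyadic_fbm H c t m w = step_integral (dyadic_step t0 t1 m (b m)) w.
  by rewrite dyadic_step_integral /dyadic_fbm gt_eqF.
exists d, M, eta; split => //; first by rewrite eta0.
- move=> n w; elim: n => [|n IH]; first by rewrite fbmE big_nat1.
  rewrite big_nat_recr//= -IH !fbmE -(@haar_step_integral _ _ t0 t1 (b n.+1)).
    by rewrite addrC subrK.
  by move=> i; apply: (dyadic_average_refine (alpha := alpha) (C := C)).
- move=> i; apply: le_trans (_ : (v i)%:E <= _)%E; last by rewrite lee_fin.
  by case: i => [|n]; exact: dyadic_step_energy.
- move=> i y; apply: (@le_trans _ _ (expR (y ^+ 2 * v i / 2))%:E).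
    by case: i => [|n]; rewrite dyadic_step_mgf.
  by rewrite lee_fin ler_expR ler_wpM2r ?invr_ge0// ler_wpM2l ?sqr_ge0.
Qed.

End dyadic_fbm_steps.

(** * Series of powers of Wiener integrals *)

Section monomial_series.
Context {R : realType}.
Variable P : probability (wiener R) R.
Variables (p : R) (r : nat).
Hypothesis p_gt1 : 1 < p.
Variables (d : nat -> @step R) (M rho : R).
Hypothesis M_gt0 : 0 < M.
Hypothesis rho_gt0 : 0 < rho.

Let sigma i : R := M * rho ^+ i.
Hypothesis energy_le : forall i,
  (\int[lebesgue_measure]_(s in `[0%R, 1%R]) ((step_fun (d i) s) ^+ 2)%:E <=
   (sigma i ^+ 2)%:E)%E.
Hypothesis mgf_le : forall i y,
  (\int[P]_w (expR (y * step_integral (d i) w))%:E <=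
   (expR (y ^+ 2 * sigma i ^+ 2 / 2))%:E)%E.

Let p_gt0 : 0 < p. Proof. exact: lt_trans p_gt1. Qed.

Let sigma_gt0 i : 0 < sigma i. Proof. by rewrite mulr_gt0// exprn_gt0. Qed.

Let X i := step_integral (d i).

Let mX i : measurable_fun setT (X i). Proof. exact: measurable_step_integral. Qed.

(** The constant does not depend on [i]: only the scale [sigma i] enters. *)
Lemma power_moment (j : nat) : exists2 D : R, 0 <= D & forall i,
  (\int[P]_w ((`|X i w| ^+ j) `^ p)%:E <= ((D * sigma i ^+ j) `^ p)%:E)%E.
Proof.
case: j => [|j].
  exists 1 => // i; under eq_integral do rewrite expr0 powR1.
  by rewrite expr0 mulr1 powR1 integral_cst//= probability_setT mule1.
have q0 : 0 < j.+1%:R * p by rewrite mulr_gt0.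
have [C C0 HC] := subgaussian_moment q0.
exists (C ^+ j.+1) => [|i]; first by rewrite exprn_ge0// ltW.
have powE (x : R) : 0 <= x -> (x ^+ j.+1) `^ p = x `^ (j.+1%:R * p).
  by move=> x0; rewrite -powR_mulrn// powRrM.
under eq_integral do rewrite powE//.
rewrite -exprMn powE; last first.
  by apply: mulr_ge0; apply: ltW.
exact: (HC _ _ P (X i) (sigma i) (sigma_gt0 i) (mX i) (mgf_le i)).
Qed.

(** The $l$-th derivative of $[h]^e$ is a multiple of
    $[h]^{e-l} h^{\otimes l}$; every order contributes the same power $e$ of the
    standard deviation. *)
Lemma monomial_moment (e : nat) : exists2 K : R, 0 <= K & forall (a : nat -> R) i l,
  (\int[P]_w ((`|sep_coef d (fun i => a i *: 'X^e) l i w| * sigma i ^+ l) `^ p)%:E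
   <= ((`|a i| * (K * sigma i ^+ e)) `^ p)%:E)%E.
Proof.
have /choice[D HD] : forall j, exists D : R, 0 <= D /\ forall i,
    (\int[P]_w ((`|X i w| ^+ j) `^ p)%:E <= ((D * sigma i ^+ j) `^ p)%:E)%E.
  by move=> j; have [D D0 HD] := power_moment j; exists D.
have D0 j : 0 <= D j by have [] := HD j.
have {}HD j := (HD j).2.
pose K := \sum_(l < e.+1) (e ^_ l)%:R * D (e - l)%N.
exists K => [|a i l]; first by apply: sumr_ge0 => l _; rewrite mulr_ge0.
pose c := `|a i| * (e ^_ l)%:R * sigma i ^+ l.
have s0 := ltW (sigma_gt0 i).
have c0 : 0 <= c by rewrite !mulr_ge0 ?exprn_ge0.
have coefE w : `|sep_coef d (fun i => a i *: 'X^e) l i w| * sigma i ^+ l =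
    c * `|X i w| ^+ (e - l).
  rewrite /sep_coef derivnZ derivnXn hornerZ hornerMn hornerXn.
  by rewrite normrM normrMn normrX /c -mulr_natr; ring.
under eq_integral do rewrite coefE powRM ?exprn_ge0// EFinM.
rewrite ge0_integralZl_EFin ?powR_ge0//; last first.
  apply/measurable_EFinP/measurable_comp_powR/measurable_funX.
  exact: measurableT_comp.
apply: (@le_trans _ _ ((c `^ p)%:E * ((D (e - l)%N * sigma i ^+ (e - l)) `^ p)%:E)%E).
  apply: lee_pmul => //; first by rewrite lee_fin powR_ge0.
  by apply: integral_ge0 => w _; rewrite lee_fin powR_ge0.
rewrite -EFinM -powRM// ?mulr_ge0 ?exprn_ge0// lee_fin.
apply: ge0_ler_powR; rewrite ?nnegrE ?mulr_ge0 ?exprn_ge0//.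
- exact: ltW.
- by apply: sumr_ge0 => j _; rewrite mulr_ge0.
have [le|el] := leqP l e; last first.
  rewrite /c ffact_small// mulr0 !mul0r !mulr_ge0 ?exprn_ge0//.
  by apply: sumr_ge0 => j _; rewrite mulr_ge0.
rewrite [leLHS](_ : _ = `|a i| * ((e ^_ l)%:R * D (e - l)%N * sigma i ^+ e)); last first.
  have rearrange (y f u D' v : R) : y * f * u * (D' * v) = y * (f * D' * (v * u)).
    by ring.
  by rewrite /c rearrange -exprD subnK.
rewrite ler_wpM2l// ler_wpM2r ?exprn_ge0// /K.
have le1 : (l < e.+1)%N by [].
rewrite (bigD1 (Ordinal le1))//= lerDl.
by apply: sumr_ge0 => j _; rewrite mulr_ge0.
Qed.

Lemma geometric_sum_le (L x : R) (S : pred nat) N n : 0 <= L -> 0 < x -> x < 1 ->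
  (forall i, S i -> (N <= i)%N) ->
  \sum_(0 <= i < n) (if S i then L * x ^+ i else 0) <= L / (1 - x) * x ^+ N.
Proof.
move=> L0 x0 x1 SN; have x1' : 0 < 1 - x by rewrite subr_gt0.
apply: (@le_trans _ _ (\sum_(0 <= i < n) if (N <= i)%N then L * x ^+ i else 0)).
  apply: ler_sum => i _; case: ifP => [/SN ->//|_].
  by case: ifP => // _; rewrite mulr_ge0 ?exprn_ge0// ltW.
have geo m : \sum_(0 <= i < m) (if (N <= i)%N then L * x ^+ i else 0) <=
    L / (1 - x) * (x ^+ N - (if (N <= m)%N then x ^+ m else x ^+ N)).
  elim: m => [|m IH].
    rewrite big_geq//; case: ifP; rewrite ?subrr ?mulr0//.
    by rewrite leqn0 => /eqP ->; rewrite subrr mulr0.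
  rewrite big_nat_recr//=; case: (leqP N m) IH => [Nm|mN] IH.
    rewrite (leq_trans Nm)//; apply: (le_trans (lerD IH (lexx _))).
    rewrite le_eqVlt; apply/orP; left; apply/eqP; rewrite exprS.
    by field; rewrite gt_eqF.
  rewrite addr0 (le_trans IH)// subrr mulr0 mulr_ge0 ?divr_ge0 ?(ltW x1')//.
  case: ifP => [Nm|_]; last by rewrite subrr.
  have -> : m.+1 = N by apply/eqP; rewrite eqn_leq mN.
  by rewrite subrr.
apply: (le_trans (geo n)); rewrite ler_wpM2l ?divr_ge0 ?(ltW x1')//.
by rewrite lerBlDr lerDl; case: ifP => _; rewrite exprn_ge0// ltW.
Qed.

Variables (e : nat) (s : nat -> R) (L x : R).
Hypothesis x_gt0 : 0 < x.
Hypothesis x_lt1 : x < 1.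
Hypothesis s_le : forall i, `|s i| * sigma i ^+ e <= L * x ^+ i.

Let L_ge0 : 0 <= L.
Proof.
have := s_le 0; rewrite expr0 mulr1; apply: le_trans.
by rewrite mulr_ge0 ?exprn_ge0 ?(ltW (sigma_gt0 _)).
Qed.

Let partial_sum (S : pred nat) n w := 
  \sum_(0 <= i < n) (if S i then s i else 0) * X i w ^+ e.

Let coef (S : pred nat) i := if S i then s i else 0.

Let coefE (S : pred nat) i w :
  sep_coef d (fun i => coef S i *: 'X^e) 0 i w = coef S i * X i w ^+ e.
Proof. by rewrite /sep_coef derivn0 hornerZ hornerXn. Qed.

Let valE (S : pred nat) n :
  sm_val (sep_functional P d (fun i => coef S i *: 'X^e) n) = partial_sum S n.
Proof.
by apply/funext => w; rewrite sm_val_sep; apply: eq_bigr => i _; exact: coefE.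
Qed.

(** The one estimate from which all Sobolev norms are read off: the index set
    [S] selects finite sums, whole series or their tails, and the bound is
    uniform in it. *)
Lemma monomial_series : exists2 K : R, 0 <= K &
  forall (S : pred nat) N, (forall i, S i -> (N <= i)%N) ->
  {ae P, forall w, cvgn (fun n => partial_sum S n w)} /\
  forall Y : wiener R -> R, measurable_fun setT Y ->
    {ae P, forall w, partial_sum S n w @[n --> \oo] --> Y w} ->
    sobolev P p r Y /\ (sobolev_norm P p r Y <= (K * x ^+ N)%:E)%E.
Proof.
have [K K0 HK] := monomial_moment e.
exists (r.+1%:R `^ p^-1 * (K * L / (1 - x))) => [|S N SN].
  by rewrite !mulr_ge0 ?powR_ge0// invr_ge0 subr_ge0 ltW.
pose g i : {poly R} := coef S i *: 'X^e.
pose beta i : R := if S i then K * L * x ^+ i else 0.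
have beta0 i : 0 <= beta i.
  by rewrite /beta; case: ifP => // _; rewrite !mulr_ge0 ?exprn_ge0// ltW.
have mom i l : (l <= r)%N ->
    (\int[P]_w ((`|sep_coef d g l i w| * sigma i ^+ l) `^ p)%:E <=
     (beta i `^ p)%:E)%E.
  move=> _; apply: le_trans (HK (coef S) i l) _; rewrite lee_fin.
  have s0 := ltW (sigma_gt0 i).
  apply: ge0_ler_powR; rewrite ?nnegrE ?mulr_ge0 ?exprn_ge0//; first exact: ltW.
  rewrite /coef /beta; case: ifP => _; last by rewrite normr0 mul0r.
  by rewrite mulrCA -mulrA ler_wpM2l.
have betaB n : \sum_(0 <= i < n) beta i <= K * L / (1 - x) * x ^+ N.
  by apply: geometric_sum_le => //; rewrite mulr_ge0.
have inner i j : `|cm_inner (cm_of_step (d i)) (cm_of_step (d j))| <=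
    sigma i * sigma j by exact: cm_inner_step_le.
split.
  have := @ae_cvg_sum R _ _ P (sep_coef d g 0) beta p _ (ltW p_gt1)
    (measurable_sep_coef d g 0) beta0 _ betaB.
  move=> H; apply: filterS (H _) => [w|i].
    move=> cv; rewrite (_ : (fun n => _) = fun n =>
      \sum_(0 <= i < n) sep_coef d g 0 i w)//.
    by apply/funext => n; apply: eq_bigr => i _; rewrite -coefE.
  apply: le_trans (mom i 0%N (leq0n r)); rewrite le_eqVlt; apply/orP; left; apply/eqP.
  by apply: eq_integral => w _; rewrite expr0 mulr1.
move=> Y mY VY; have VY' : {ae P, forall w,
    sm_val (sep_functional P d g n) w @[n --> \oo] --> Y w}.
  by apply: filterS VY => w; under [in X in _ -> X]eq_fun do rewrite valE.
split.
  exact: (sobolev_sep p_gt1 inner (fun i => ltW (sigma_gt0 i)) beta0 mom betaB).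
rewrite -mulrA.
exact: (sobolev_norm_sep_le p_gt1 inner (fun i => ltW (sigma_gt0 i)) beta0 mom betaB).
Qed.

End monomial_series.

(** * Capacities *)

Section capacity.
Context {R : realType}.
Variables (P : probability (wiener R) R) (p : R) (r : nat).

Lemma sobolev_norm_ge0 X : (0 <= sobolev_norm P p r X)%E.
Proof.
apply: le_ereal_inf_tmp => c [F _ Fc]; rewrite -(cvg_lim _ Fc)//.
apply: lime_ge; first by apply/cvg_ex; exists c.
by apply: nearW => k; exact: poweR_ge0.
Qed.

Lemma capacity_ge0 A : (0 <= capacity P p r A)%E.
Proof.
apply: le_ereal_inf_tmp => _ [U _ <-].
apply: le_ereal_inf_tmp => _ [Y _ <-]; exact: sobolev_norm_ge0.
Qed.

(** Chebyshev's inequality for capacities is this bound, with [X] of the form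
    $\sum_i (X_i / \lambda_i)^2$. *)
Lemma capacity_le (A O : set (wiener R)) (X : wiener R -> R) :
  open O -> A `<=` O -> sobolev P p r X ->
  {ae P, forall w, O w -> 1 <= X w} -> {ae P, forall w, 0 <= X w} ->
  (capacity P p r A <= sobolev_norm P p r X)%E.
Proof.
move=> oO AO sX X1 X0; apply: (@le_trans _ _ (open_capacity P p r O)).
  by apply: ereal_inf_lbound; exists O.
by apply: ereal_inf_lbound; exists X.
Qed.

End capacity.

Lemma geometric_le_small (R : realType) (K x e : R) : 0 <= K -> 0 < x -> x < 1 ->
  0 < e -> exists N, forall n, (N <= n)%N -> K * x ^+ n <= e.
Proof.
move=> K0 x0 x1 e0.
have cx : K * x ^+ n @[n --> \oo] --> (0 : R).
  rewrite -(mulr0 K); apply: cvgMr; apply: cvg_expr.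
  by rewrite ger0_norm// ltW.
have /cvgrPdist_le/(_ e e0)[N _ HN] := cx.
exists N => n /HN /=; rewrite sub0r normrN; apply: le_trans.
exact: ler_norm.
Qed.

Lemma cvg_sum_geometric (R : realType) (u : nat -> R) (x : R) N :
  0 < x -> x < 1 -> (forall i, (N <= i)%N -> `|u i| <= x ^+ i) ->
  cvgn (fun n => \sum_(0 <= i < n) u i).
Proof.
move=> x0 x1 ux; apply: normed_cvg; apply: nondecreasing_is_cvgn.
  move=> n m nm; rewrite /series/= [leRHS](big_cat_nat (n := n))//= lerDl.
  exact: sumr_ge0.
exists (\sum_(0 <= i < N) `|u i| + 1 / (1 - x) * x ^+ N) => _ [n _ <-] /=.
apply: (@le_trans _ _ (\sum_(0 <= i < maxn N n) `|u i|)).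
  by rewrite [leRHS](big_cat_nat (n := n)) ?leq_maxr//= lerDl sumr_ge0.
rewrite (big_cat_nat (n := N)) ?leq_maxl//= lerD2l.
have := @geometric_sum_le R 1 x [pred i | (N <= i)%N] N (maxn N n) ler01 x0 x1
  (fun i => id).
apply: le_trans.
rewrite [leRHS](big_cat_nat (n := N)) ?leq_maxl//=.
rewrite -[leLHS]add0r lerD//.
  apply: sumr_ge0 => i _; case: ifP => // _.
  by rewrite mul1r exprn_ge0// ltW.
rewrite big_nat_cond [leRHS]big_nat_cond; apply: ler_sum => i.
by move=> /andP[/andP[Ni _] _]; rewrite Ni mul1r ux.
Qed.

Theorem theorem4p2 (R : realType) (P : probability (wiener R) R)
    (hP : wiener_measure P) (H c : R) (hH : H \in `[2^-1, 1[)
    (hc : fbm_constant P H c) (r : nat) (p : R) (hp : 1 < p)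
    (t : R) (ht : t \in `[0, 1]) :
  exists B : wiener R -> R,
    quasi_surely P p r (fun w => dyadic_fbm H c t m.+1 w @[m --> \oo] --> B w) /\
    cvg_sobolev P p r (fun m => dyadic_fbm H c t m.+1) B.
Proof.
have [d [M [eta [M0 /andP[eta0 eta1] fbmE energy mgf]]]] :=
  dyadic_fbm_steps hP hH hc.1 ht.
pose rho := eta ^+ 2; pose X i := step_integral (d i).
have rho0 : 0 < rho by rewrite exprn_gt0.
have rho1 : rho < 1 by rewrite exprn_ilt1// ltW.
have etaE i : eta ^+ i.*2 = rho ^+ i by rewrite -mul2n exprM.
have mX i : measurable_fun setT (X i) by exact: measurable_step_integral.
pose V n w := \sum_(0 <= i < n) X i w.
have mV n : measurable_fun setT (V n) by exact: measurable_sum.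
have VE n w : dyadic_fbm H c t n.+1 w = V n.+1 w by exact: fbmE.
pose B := ae_limit V.
have mB : measurable_fun setT B by exact: measurable_ae_limit.
have lin1 (s : nat -> R) : (forall i, `|s i| <= 1) ->
    forall i, `|s i| * (M * rho ^+ i) ^+ 1 <= M * rho ^+ i.
  by move=> s1 i; rewrite expr1 ler_piMl// mulr_ge0 ?exprn_ge0// ltW.
have one1 (i : nat) : `|1 : R| <= 1 by rewrite normr1.
have mone1 (i : nat) : `|-1 : R| <= 1 by rewrite normrN1.
have [K1 K10 lin] := monomial_series r hp M0 rho0 energy mgf rho0 rho1
  (lin1 (fun=> 1) one1).
have [K2 K20 opp] := monomial_series r hp M0 rho0 energy mgf rho0 rho1
  (lin1 (fun=> -1) mone1).
(* the weights of $\sum_i (X_i / \eta^i)^2$ *)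
pose a i := (rho ^+ i)^-1.
have a0 i : 0 < a i by rewrite invr_gt0 exprn_gt0.
have quad_le i : `|a i| * (M * rho ^+ i) ^+ 2 <= M ^+ 2 * rho ^+ i.
  rewrite gtr0_norm// /a le_eqVlt; apply/orP; left; apply/eqP.
  by field; rewrite expf_neq0// gt_eqF.
have [K3 K30 quad] := monomial_series r hp M0 rho0 energy mgf rho0 rho1 quad_le.
have VB : {ae P, forall w, V n w @[n --> \oo] --> B w}.
  have [+ _] := lin xpredT 0%N (fun i _ => leq0n i).
  apply: filterS => w cv; apply: cvg_ae_limit.
  rewrite (_ : V ^~ w = fun n => \sum_(0 <= i < n) 1 * X i w ^+ 1)//.
  by apply/funext => n; apply: eq_bigr => i _; rewrite mul1r expr1.
exists B; split.
(* outside the open sets [O], of arbitrarily small capacity, the series is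
   dominated by a geometric one *)
  apply/eqP; rewrite eq_le capacity_ge0 andbT.
  apply/lee_addgt0Pr => e e0; rewrite add0e.
  have [N HN] := geometric_le_small K30 rho0 rho1 e0.
  pose S := [pred i | (N <= i)%N].
  have SN i : S i -> (N <= i)%N by [].
  pose W n w := \sum_(0 <= i < n) (if S i then a i else 0) * X i w ^+ 2.
  have mW n : measurable_fun setT (W n).
    by apply: measurable_sum => i; apply: measurable_funM => //; exact: measurable_funX.
  have [cW normW] := quad S N SN.
  have Wphi : {ae P, forall w, W n w @[n --> \oo] --> ae_limit W w}.
    by apply: filterS cW => w; exact: cvg_ae_limit.
  have [sphi nphi] := normW _ (measurable_ae_limit mW) Wphi.
  have W_homo w n m : (n <= m)%N -> W n w <= W m w.
    move=> nm; rewrite /W [leRHS](big_cat_nat (n := n))//= lerDl.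
    apply: sumr_ge0 => i _; rewrite mulr_ge0 ?sqr_ge0//.
    by case: ifP => // _; exact: ltW.
  have Wle w n : W j w @[j --> \oo] --> ae_limit W w -> W n w <= ae_limit W w.
    move=> Ww; rewrite -(cvg_lim _ Ww)//.
    apply: (@nondecreasing_cvgn_le _ (W ^~ w)); first by move=> i j; exact: W_homo.
    by apply/cvg_ex; exists (ae_limit W w).
  pose O := \bigcup_(i in [set i | (N <= i)%N]) [set w | eta ^+ i < `|X i w|].
  apply: (@le_trans _ _ (sobolev_norm P p r (ae_limit W))); last first.
    by rewrite (le_trans nphi)// lee_fin HN.
  apply: (@capacity_le _ _ _ _ _ O) => //.
  - apply: bigcup_open => i _.
    have /continuousP cX : continuous (fun w => `|X i w|).
      move=> w; apply: (@continuous_comp _ _ _ (X i) (fun z : R => `|z|)).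
        exact: continuous_step_integral.
      exact: norm_continuous.
    exact: (cX _ (@open_gt _ (eta ^+ i))).
  - move=> w /= nB; apply: contrapT => nO; apply: nB.
    have Xle i : (N <= i)%N -> `|X i w| <= eta ^+ i.
      by move=> Ni; rewrite leNgt; apply/negP => Xi; apply: nO; exists i.
    have := @cvg_ae_limit _ _ _ V w (cvg_sum_geometric eta0 eta1 Xle).
    rewrite -(cvg_shiftS (V ^~ w)) (_ : (fun m => _) = (fun m => V m.+1 w))//.
    by apply/funext => m; exact: VE.
  - apply: filterS Wphi => w Ww [i /= Ni Xi].
    apply: le_trans (Wle _ i.+1 Ww).
    rewrite /W big_nat_recr//= Ni; apply: (@le_trans _ _ (a i * X i w ^+ 2)).
      rewrite /a -etaE mulrC ler_pdivlMr ?exprn_gt0// mul1r -muln2 exprM.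
      rewrite -(real_normK (num_real (X i w))) lerXn2r ?nnegrE ?exprn_ge0//.
        exact: ltW.
      exact: ltW.
    rewrite lerDr; apply: sumr_ge0 => j _; rewrite mulr_ge0 ?sqr_ge0//.
    by case: ifP => // _; exact: ltW.
  - by apply: filterS Wphi => w Ww; apply: le_trans (Wle _ 0%N Ww); rewrite /W big_geq.
split.
- move=> m; have [_ +] := lin [pred i | (i < m.+1)%N] 0%N (fun i _ => leq0n i).
  move=> /(_ (V m.+1) (mV _) _)[|sV _].
    apply: nearW => w; apply: cvg_near_cst; exists m.+1 => // n /= mn.
    rewrite (big_cat_nat (n := m.+1))//= [X in _ + X]big_nat_cond.
    rewrite [X in _ + X]big1 ?addr0; last first.
      by move=> j /andP[/andP[mj _] _]; rewrite ltnNge mj mul0r.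
    by apply: eq_big_nat => j /andP[_ ->]; rewrite mul1r expr1.
  rewrite (_ : dyadic_fbm H c t m.+1 = V m.+1)//.
  by apply/funext => w; exact: VE.
- have [_ +] := lin xpredT 0%N (fun i _ => leq0n i).
  move=> /(_ B mB _)[|//]; apply: filterS VB => w.
  rewrite (_ : (fun n => _) = V ^~ w)//.
  by apply/funext => n; apply: eq_bigr => i _; rewrite mul1r expr1.
(* the error is the tail of the series from index [m.+1] on *)
- apply: cvge0P => [m|e e0]; first exact: sobolev_norm_ge0.
  have [N HN] := geometric_le_small K20 rho0 rho1 e0.
  exists N => m Nm.
  have [_ +] := opp [pred i | (m.+1 <= i)%N] m.+1 (fun i => id).
  move=> /(_ (fun w => dyadic_fbm H c t m.+1 w - B w) _ _)[||_ le].
  + apply: measurable_funB => //; rewrite (_ : dyadic_fbm _ _ _ _ = V m.+1)//.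
    by apply/funext => w; exact: VE.
  + apply: filterS VB => w VBw; rewrite VE.
    apply: (@cvg_trans _ ((V m.+1 w - V n w) @[n --> \oo])); last first.
      by apply: cvgB => //; exact: cvg_cst.
    apply: near_eq_cvg; exists m.+1 => // n /= mn.
    rewrite [RHS](big_cat_nat (n := m.+1))//= [X in _ = X + _]big_nat_cond.
    rewrite [X in _ = X + _]big1 ?add0r; last first.
      by move=> j /andP[/andP[_ jm] _]; rewrite leqNgt jm mul0r.
    rewrite /V [X in _ - X](big_cat_nat (n := m.+1))//= opprD addrA subrr add0r.
    rewrite -sumrN; apply: eq_big_nat => j /andP[-> _].
    by rewrite mulN1r expr1.
  + by rewrite (le_trans le)// lee_fin HN// ltnW.
Qed.
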